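(* Let $A$ be a finite alphabet, $X\subseteq A^{\mathbb Z}$ a two-sided subshift, and $f=\sigma|_X$. Assume there are a non-empty compact set $Y\subseteq X$ and a positive integer $N$ such that $f^N(Y)=Y$, $X=\bigcup_{l=0}^{N-1}f^l(Y)$ and $(Y,f^N)$ has the non-uniform specification property. For each $j\ge1$ let $\varphi_j:\mathbb N\to(0,1]$, let $\mathcal Z_j=\{z_j^i\}_{i=0}^\infty\subset X$, and let $S_j=\{s_j^i\}_{i=0}^\infty\subset\mathbb N$ be a sequence of positive integers with $\lim_{i\to\infty}s_j^i=\infty$. Put $\overline\tau:=\sup_{j\ge1}\limsup_{n\to\infty}-\frac{\ln\varphi_j(n)}{n}$, $\underline\tau:=\sup_{j\ge1}\liminf_{n\to\infty}-\frac{\ln\varphi_j(n)}{n}$ and $\mathfrak S_\infty:=\bigcap_{j=1}^\infty\mathfrak S(f,\varphi_j,\mathcal Z_j,S_j)$. (1) If $\overline\tau<1$ and $\bigcap_{j=1}^\infty\mathrm{Ind}'(\mathcal Z_j,S_j,Y)\ne\emptyset$, then $\mathfrak S_\infty$ is non-empty and $$\frac{1-\overline\tau}{1+\overline\tau}h_{top}(f,X)\le h_{top}(f,\mathfrak S_\infty)\le\frac{1-\underline\tau}{1+\underline\tau}h_{top}(f,X),$$ $$\frac2{1+\overline\tau}h_{top}(f,X)\le\dim_H\mathfrak S_\infty\le\frac2{1+\underline\tau}h_{top}(f,X).$$ When moreover $Y=X$, $N=1$ and $S_j=\mathbb N$ for all $j\ge1$, $$h_{top}(f,\mathfrak S_\infty)=\frac{1-\underline\tau}{1+\underline\tau}h_{top}(f,X),\qquad\dim_H\mathfrak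 S_\infty=\frac2{1+\underline\tau}h_{top}(f,X).$$ (2) If $\underline\tau=1$, then $h_{top}(f,\mathfrak S_\infty)=0$ and $\dim_H\mathfrak S_\infty\le h_{top}(f,X)$. (3) If $\underline\tau>1$, then $h_{top}(f,\mathfrak S_\infty)=0$ and $\dim_H\mathfrak S_\infty=0$.
   Context: $\mathbb N$ is the set of non-negative integers. $A^{\mathbb Z}$ is the set of bi-infinite sequences over $A$ with shift $(\sigma(x))_n=x_{n+1}$ and metric $d(\omega,\gamma)=e^{-\min\{|k|:k\in\mathbb Z,\ \omega_k\ne\gamma_k\}}$ for $\omega\ne\gamma$, $d(\omega,\omega)=0$. A two-sided subshift is a closed $\sigma$-invariant subset $X\subseteq A^{\mathbb Z}$. $X$ is assumed to have at least two points. Shrinking target set: $\mathfrak S(f,\varphi,\mathcal Z,S):=\{x\in X: d(f^n(x),z_n)<\varphi(n)\text{ for infinitely many }n\in S\}$; for $\mathcal Z_j=\{z_j^i\}_{i\ge0}$ the centre at time $n$ is $z_j^n$. Index sets: for $\mathcal Z=\{z_i\}_{i=0}^\infty\subset X$ and positive integers $S=\{s_i\}_{i=0}^\infty$ with $s_i\to\infty$, $\mathrm{Ind}(\mathcal Z,S,Y)$ is the set of $(I_1,I_2)\in\{0,\dots,N-1\}^2$ such that there are infinitely many $i$ with $z_{s_i}\in f^{I_1}(Y)$ and $N\mid(s_i-I_2)$; $\mathrm{Ind}'(\mathcal Z,S,Y):=\{I_1-I_2:(I_1,I_2)\in\mathrm{Ind}(\mathcal Z,S,Y)\}$. Dynamical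 ball: $B_n(x,\varepsilon,g)=\{y: d(g^i(x),g^i(y))<\varepsilon,\ 0\le i\le n-1\}$. $(W,g)$ has the non-uniform specification property if for every scale $\varepsilon>0$ and every $n\ge1$ there is a positive integer $p(n,\varepsilon)$ with $\limsup_{n\to\infty}\frac1np(n,\varepsilon)=0$ such that for any $x_1,\dots,x_k\in W$, positive integers $n_1,\dots,n_k$ and $p_i\ge p(n_i,\varepsilon)$ there is $z\in W$ with $z\in B_{n_1}(x_1,\varepsilon,g)$ and $g^{n_1+p_1+\cdots+n_{i-1}+p_{i-1}}(z)\in B_{n_i}(x_i,\varepsilon,g)$ for $2\le i\le k$. Bowen topological entropy of a subset $Z\subseteq X$: for $s\ge0$, $m\ge 1$, $\varepsilon>0$ let $\mathcal M^s_{m,\varepsilon}(Z)=\inf\sum_i e^{-sn_i}$ over finite or countable families $\{B_{n_i}(x_i,\varepsilon,f)\}$ covering $Z$ with $x_i\in X$, $n_i\ge m$; $\mathcal M^s_\varepsilon(Z)=\lim_{m\to\infty}\mathcal M^s_{m,\varepsilon}(Z)$; $h_{top}(f,Z,\varepsilon)=\inf\{s:\mathcal M^s_\varepsilon(Z)=0\}$; $h_{top}(f,Z)=\lim_{\varepsilon\to0}h_{top}(f,Z,\varepsilon)$. $\dim_H$ is Hausdorff dimension with respect to $d$. *)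

(* Defs.v *)
From HB Require Import structures.
From mathcomp Require Import all_boot all_order all_algebra.
From mathcomp Require Import all_classical all_reals all_analysis.
Import Order.TTheory GRing.Theory Num.Theory.
Import numFieldNormedType.Exports.

Set Implicit Arguments.
Unset Strict Implicit.
Unset Printing Implicit Defensive.

Local Open Scope classical_set_scope.
Local Open Scope ring_scope.

(** Bi-infinite sequences. The type carries the field R only so that the
    R-valued metric below can be its canonical metric structure. *)

Definition biseq (R : realType) (A : finType) : Type := int -> A.

HB.instance Definition _ (R : realType) (A : finType) :=
  gen_eqMixin (biseq R A).
HB.instance Definition _ (R : realType) (A : finType) :=
  gen_choiceMixin (biseq R A).

Section BiseqMetric.
Variables (R : realType) (A : finType).
Implicit Types w v u : biseq R A.

Definition differ_at w v (n : nat) : bool :=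
  `[< exists2 k : int, absz k = n & w k <> v k >].

(* e^{- min {|k| : w_k <> v_k}}; the second branch is the case w = v,
   see [biseq_dist_eq0]. *)
Definition biseq_dist w v : R :=
  if pselect (exists n, differ_at w v n) is left h
  then expR (- (ex_minn h)%:R) else 0.

Lemma biseq_dist_ge w v n : differ_at w v n -> expR (- n%:R) <= biseq_dist w v.
Proof.
rewrite /biseq_dist => dn; case: pselect => [h|[]]; last by exists n.
case: ex_minnP => m _ /(_ _ dn) mn.
by rewrite ler_expR lerN2 ler_nat.
Qed.

Lemma biseq_dist_ge0 w v : 0 <= biseq_dist w v.
Proof. by rewrite /biseq_dist; case: pselect => // h; exact: expR_ge0. Qed.

Lemma biseq_distxx w : biseq_dist w w = 0.
Proof.
rewrite /biseq_dist; case: pselect => // -[n dn]; exfalso.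
by move/asboolP: dn => [k _].
Qed.

Lemma biseq_dist_eq0 w v : biseq_dist w v = 0 -> w = v.
Proof.
move=> d0; apply/funext => k; apply: contrapT => wv.
have /biseq_dist_ge : differ_at w v (absz k) by apply/asboolP; exists k.
by rewrite d0 leNgt expR_gt0.
Qed.

Lemma biseq_dist_sym w v : biseq_dist w v = biseq_dist v w.
Proof.
rewrite /biseq_dist; have -> // : differ_at w v = differ_at v w.
apply/funext => n; apply/asboolP/asboolP => -[k kn wv]; exists k => //;
exact: nesym.
Qed.

Lemma biseq_dist_triangle v w u :
  biseq_dist w u <= biseq_dist w v + biseq_dist v u.
Proof.
rewrite {1}/biseq_dist; case: pselect => [h|_]; last first.
  by rewrite addr_ge0// biseq_dist_ge0.
case: ex_minnP => n /asboolP[k kn wu] _.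
have [wv|wv] := pselect (w k = v k).
- apply: (le_trans (biseq_dist_ge (w := v) (v := u) _)).
    by apply/asboolP; exists k => //; rewrite -wv.
  by rewrite lerDr biseq_dist_ge0.
- apply: (le_trans (biseq_dist_ge (w := w) (v := v) _)).
    by apply/asboolP; exists k.
  by rewrite lerDl biseq_dist_ge0.
Qed.

HB.instance Definition _ := isMetric.Build R (biseq R A)
  biseq_distxx biseq_dist_eq0 biseq_dist_sym biseq_dist_triangle.

Definition sigma_shift w : biseq R A := fun n => w (n + 1).

Definition subshift (X : set (biseq R A)) : Prop :=
  closed X /\ sigma_shift @` X = X.

End BiseqMetric.

Section Dynamics.
Variables (R : realType) (T : metricType R).
Implicit Types (g : T -> T) (W X Y Z : set T).

Definition dyn_ball W g (n : nat) (x : T) (e : R) : set T :=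
  [set y | W y /\
    forall i, (i < n)%N -> mdist (iter i g x) (iter i g y) < e].

(* Segments are numbered 0, ..., k-1. *)
Definition nonuniform_spec W g : Prop :=
  forall e : R, 0 < e ->
  exists p : nat -> nat,
  [/\ forall n, (0 < n)%N -> (0 < p n)%N,
      limn_esup (fun n => ((p n)%:R / n%:R : R)%:E) = 0%E
    & forall (k : nat) (x : 'I_k -> T) (n q : 'I_k -> nat), (0 < k)%N ->
        (forall i, W (x i)) -> (forall i, (0 < n i)%N) ->
        (forall i, (p (n i) <= q i)%N) ->
        exists2 z, W z &
          forall i : 'I_k, dyn_ball W g (n i) (x i) e
            (iter (\sum_(j < k | (j < i)%N) (n j + q j))%N g z)].

Definition bowen_sum X g (s : R) (m : nat) (e : R) Z : \bar R :=
  ereal_inf [set v | exists (D : set nat) (n : nat -> nat) (x : nat -> T),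
    [/\ forall i, D i -> X (x i) /\ (m <= n i)%N,
        Z `<=` \bigcup_(i in D) dyn_ball X g (n i) (x i) e
      & v = (\esum_(i in D) (expR (- s * (n i)%:R))%:E)%E]].

Definition bowen_measure X g (s e : R) Z : \bar R :=
  limn (fun m => bowen_sum X g s m e Z).

Definition htop_scale X g Z (e : R) : \bar R :=
  ereal_inf [set s%:E | s in [set s | 0 <= s /\ bowen_measure X g s e Z = 0%E]].

Definition htop X g Z : \bar R := lim (htop_scale X g Z e @[e --> 0^'+]).

(* The 0 makes the diameter of the empty set 0 rather than -oo. *)
Definition diam (U : set T) : \bar R :=
  ereal_sup (0%E |` [set (mdist p.1 p.2)%:E | p in U `*` U]).

Definition hausdorff_premeasure (s d : R) Z : \bar R :=
  ereal_inf [set v | exists (D : set nat) (U : nat -> set T),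
    [/\ forall i, D i -> (diam (U i) <= d%:E)%E,
        Z `<=` \bigcup_(i in D) U i
      & v = (\esum_(i in D) poweR (diam (U i)) s)%E]].

Definition hausdorff_measure (s : R) Z : \bar R :=
  lim (hausdorff_premeasure s d Z @[d --> 0^'+]).

Definition hausdorff_dim Z : \bar R :=
  ereal_inf [set s%:E | s in [set s | 0 <= s /\ hausdorff_measure s Z = 0%E]].

Definition shrinking_target X g (phi : nat -> R) (z : nat -> T) (S : set nat) :
    set T :=
  [set x | X x /\
    infinite_set [set n | S n /\ mdist (iter n g x) (z n) < phi n]].

Definition Ind g (N : nat) (z : nat -> T) (s : nat -> nat) Y :
    set (nat * nat) :=
  [set I | [/\ (I.1 < N)%N, (I.2 < N)%N &
    infinite_set [set i | (iter I.1 g @` Y) (z (s i)) /\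
                          (N%:Z %| (s i)%:Z - I.2%:Z)%Z]]].

(* Differences are taken in the integers. *)
Definition Ind' g (N : nat) (z : nat -> T) (s : nat -> nat) Y : set int :=
  [set I.1%:Z - I.2%:Z | I in Ind g N z s Y].

End Dynamics.

Definition decay_limsup (R : realType) (phi : nat -> R) : \bar R :=
  limn_esup (fun n => (- ln (phi n) / n%:R)%:E).

Definition decay_liminf (R : realType) (phi : nat -> R) : \bar R :=
  limn_einf (fun n => (- ln (phi n) / n%:R)%:E).

(* Main.v *)
(** Upper bounds: a point of the target set lies, for infinitely many n, in a set
    where the coordinates in [n - tn, n + tn] are prescribed. Covering these sets by
    cylinders leaves only the coordinates in [0, n - tn) (for the entropy) or
    [-(n + tn), n - tn) (for the dimension) to be enumerated, and X has at most
    e^(h'M) words of length M for h' > h, M large.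

    Lower bounds: write W for the number of words of length nN of Y. By specification,
    the words of Y can be chosen freely in consecutive blocks of length L = (n + p n) N,
    except for the blocks that are overwritten by forced windows centred at very sparse
    target times T_k, where an orbit segment of the target of length about 2 tau T_k is
    copied. The points that match all the windows form a compact set, the free blocks
    have lower density at least kappa, for any kappa < (1 - tau)/(1 + tau), and in any
    cover of that set by cylinders a cylinder containing q free blocks has weight W^(-q)
    with total weight at least 1. With the trivial target set the same count gives
    ln W <= h L, which bounds the number of words of X; conversely h <= ln W / (nN) by
    submultiplicativity of the number of words. *)

From HB Require Import structures.
Require Import Defs.
From mathcomp Require Import all_boot all_order all_algebra.
From mathcomp Require Import all_classical all_reals all_analysis.
From mathcomp Require Import zify ring lra.
Import Order.TTheory GRing.Theory Num.Theory.
Import numFieldNormedType.Exports.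

Local Open Scope classical_set_scope.
Local Open Scope ring_scope.
Set Implicit Arguments.
Unset Strict Implicit.
Unset Printing Implicit Defensive.

(** * Agreement of sequences on windows *)

Section Sequences.
Variables (R : realType) (A : finType).
Local Notation B := (biseq R A).
Implicit Types x y w v : B.
Implicit Types X Y Z : set B.
Local Notation f := (@sigma_shift R A).

(** A window of radius tau T about T covers [(1 - tau)T, (1 + tau)T]. When earlier windows are
    negligible against T, the worst prefix ends at (1 + tau)T and has about (1 - tau)T free
    coordinates: this is the ratio (1 - tau)/(1 + tau). Negative coordinates are never forced, so a
    symmetric cylinder has free proportion kappa on one side and 1 on the other, and 1 + (1 -
    tau)/(1 + tau) = 2/(1 + tau). No measure is built: after reduction to a finite cover, the mass
    argument is a count of block assignments. Two obstacles shape the construction. Specification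
    concerns f^N on Y, so orbits are copied at multiples of N only; a centre in f^I1(Y) at a time
    congruent to I2 fits after moving the point by c = I1 - I2, and since one point serves all j, c
    must be common to all j. Moreover, specification glues finitely many forward segments, while
    infinitely many windows and also negative blocks are prescribed; shifts by multiples of N and a
    cluster point bridge this. The lower bound asks only for arbitrarily large good times, so the
    limsup and liminf cases share it. *)

Definition agree (a b : int) x y := forall k : int, a <= k -> k < b -> x k = y k.

Definition shiftz (c : int) w : B := fun k => w (k + c).

Lemma agree_sym a b x y : agree a b x y -> agree a b y x.
Proof. by move=> xy k ak kb; rewrite xy. Qed.

Lemma agree_trans a b x y v : agree a b x y -> agree a b y v -> agree a b x v.
Proof. by move=> xy yv k ak kb; rewrite xy // yv. Qed.

Lemma agree_sub a b a' b' x y :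
  a <= a' -> b' <= b -> agree a b x y -> agree a' b' x y.
Proof. by move=> aa bb xy k ak kb; apply: xy; lia. Qed.

Lemma agree_shiftz a b c x y :
  agree a b (shiftz c x) (shiftz c y) <-> agree (a + c) (b + c) x y.
Proof.
split=> xy k ak kb; last by apply: xy; lia.
by have := xy (k - c); rewrite /shiftz subrK; apply; lia.
Qed.

Lemma shiftzD c d w : shiftz c (shiftz d w) = shiftz (c + d) w.
Proof. by apply/funext => k; rewrite /shiftz addrA. Qed.

Lemma shiftz0 w : shiftz 0 w = w.
Proof. by apply/funext => k; rewrite /shiftz addr0. Qed.

Lemma shiftzK c : cancel (shiftz c) (shiftz (- c)).
Proof. by move=> w; rewrite shiftzD addNr shiftz0. Qed.

Lemma agree_shiftzr a b c x y :
  agree a b x (shiftz c y) <-> agree (a + c) (b + c) (shiftz (- c) x) y.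
Proof. by rewrite -agree_shiftz shiftzD subrr shiftz0. Qed.

Lemma iter_shift n w : iter n f w = shiftz n%:Z w.
Proof.
elim: n => [|n IH] /=; first by rewrite shiftz0.
by rewrite IH; apply/funext => k; rewrite /sigma_shift /shiftz; congr w; lia.
Qed.

Lemma iter_iter_shift N n w : iter n (iter N f) w = shiftz (n * N)%N%:Z w.
Proof.
elim: n => [|n IH] /=; first by rewrite shiftz0.
by rewrite IH iter_shift shiftzD; congr shiftz; lia.
Qed.

(** Negative multiples come from the surjectivity of f^N on [Z]: the preimage found in [Z] is the
    inverse shift, because [shiftz] is invertible. *)
Lemma shiftz_stable N Z c w : iter N f @` Z = Z -> Z w -> Z (shiftz (N%:Z * c) w).
Proof.
move=> ZN; have up n v : Z v -> Z (shiftz (N%:Z * n%:Z) v).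
  elim: n v => [|n IH] v Zv; first by rewrite mulr0 shiftz0.
  have -> : N%:Z * n.+1%:Z = N%:Z * n%:Z + N%:Z by lia.
  by rewrite -shiftzD; apply: IH; rewrite -ZN; exists v; rewrite // iter_shift.
have dn n v : Z v -> Z (shiftz (- (N%:Z * n%:Z)) v).
  elim: n v => [|n IH] v Zv; first by rewrite mulr0 oppr0 shiftz0.
  have -> : - (N%:Z * n.+1%:Z) = - (N%:Z * n%:Z) + - N%:Z by lia.
  rewrite -shiftzD; apply: IH; move: Zv; rewrite -{1}ZN => -[u Zu <-].
  by rewrite iter_shift shiftzK.
case: c => n Zw; first exact: up.
by rewrite NegzE mulrN; apply: dn.
Qed.

Lemma mdist_lt_agree (r : R) (m : nat) x y : mdist x y < expR (- r) -> m%:R <= r ->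
  agree (- m%:Z) (m%:Z + 1) x y.
Proof.
move=> xyr mr k ak kb; apply: contrapT => xyk.
have : differ_at x y (absz k) by apply/asboolP; exists k.
move/biseq_dist_ge; apply/negP; rewrite -ltNge; apply: (lt_le_trans xyr).
by rewrite ler_expR lerN2; apply: le_trans mr; rewrite ler_nat; lia.
Qed.

Lemma agree_mdist_lt (m : nat) x y : agree (- m%:Z) (m%:Z + 1) x y ->
  mdist x y < expR (- m%:R).
Proof.
move=> xy; rewrite [mdist _ _]/(biseq_dist x y) /biseq_dist.
case: pselect => [h|_]; last exact: expR_gt0.
case: ex_minnP => n /asboolP[k kn xyk] _; rewrite ltr_expR ltrN2 ltr_nat.
by rewrite ltnNge; apply/negP => nm; apply: xyk; apply: xy; lia.
Qed.

Lemma agree_mdist_le (m : nat) x y : agree (- m%:Z) m%:Z x y ->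
  mdist x y <= expR (- m%:R).
Proof.
move=> xy; rewrite [mdist _ _]/(biseq_dist x y) /biseq_dist.
case: pselect => [h|_]; last exact: expR_ge0.
case: ex_minnP => n /asboolP[k kn xyk] _; rewrite ler_expR lerN2 ler_nat.
by rewrite leqNgt; apply/negP => nm; apply: xyk; apply: xy; lia.
Qed.

(** A non-strict bound controls |k| < m only, whereas a strict one also reaches |k| = m. Balls and
    targets are strict, diameters are not. *)
Lemma mdist_le_agree (r : R) (m : nat) x y : mdist x y <= expR (- r) -> m%:R <= r ->
  agree (- m%:Z + 1) m%:Z x y.
Proof.
move=> xyr mr k ak kb; apply: contrapT => xyk.
have : differ_at x y (absz k) by apply/asboolP; exists k.
move/biseq_dist_ge; apply/negP; rewrite -ltNge; apply: (le_lt_trans xyr).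
by rewrite ltr_expR ltrN2; apply: lt_le_trans mr; rewrite ltr_nat; lia.
Qed.

Lemma dyn_ball_agree X n x y (e : R) :
  e <= 1 -> dyn_ball X f n x e y -> agree 0 n%:Z x y.
Proof.
move=> e1 [_ xy] k k0 kn; have kN : k = (absz k)%:Z by lia.
have : mdist (iter (absz k) f x) (iter (absz k) f y) < expR (- 0).
  by rewrite oppr0 expR0; apply: lt_le_trans e1; apply: xy; lia.
move/(@mdist_lt_agree _ 0) => /(_ (lexx _) 0); rewrite !iter_shift /shiftz.
by rewrite !add0r -kN; apply; lia.
Qed.

Lemma agree_dyn_ball X n x y (e : R) (k : nat) : expR (- k%:R) <= e -> X y ->
  agree (- k%:Z) (n + k)%N%:Z x y -> dyn_ball X f n x e y.
Proof.
move=> ke Xy xy; split=> // i ni; apply: lt_le_trans ke.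
apply: agree_mdist_lt; rewrite !iter_shift agree_shiftz.
by apply: agree_sub xy; lia.
Qed.

(** Coordinate k is read off from iterate number k / N, which brings it within distance N of the
    origin. *)
Lemma spec_ball_agree Z N n x y : (0 < N)%N ->
  dyn_ball Z (iter N f) n x (expR (- N%:R)) y ->
  agree 0 (n * N)%N%:Z x y.
Proof.
move=> N0 [_ xy] k k0 kn; pose i := (absz k %/ N)%N.
have iN : (i < n)%N by rewrite ltn_divLR //; lia.
have := xy i iN; rewrite !iter_iter_shift => /(@mdist_lt_agree _ N) /(_ (lexx _)).
rewrite agree_shiftz; apply.
  by have := leq_trunc_div (absz k) N; rewrite -/i; lia.
by have := ltn_ceil (absz k) N0; rewrite -/i; lia.
Qed.

Lemma open_agree a b x : open [set y | agree a b x y].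
Proof.
rewrite openE => y /= xy; apply/nbhs_ballP.
pose m := (absz a + absz b)%N.
exists (expR (- m%:R)); first exact: expR_gt0.
move=> v; rewrite ballEmdist /= => /(@mdist_lt_agree _ m)/(_ (lexx _)) yv.
by apply: (agree_trans xy); apply: agree_sub yv; lia.
Qed.

Lemma closed_agree a b x : closed [set y | agree a b x y].
Proof.
rewrite -openC openE => y /= nxy; apply/nbhs_ballP.
pose m := (absz a + absz b)%N.
exists (expR (- m%:R)); first exact: expR_gt0.
move=> v; rewrite ballEmdist /= => /(@mdist_lt_agree _ m)/(_ (lexx _)) yv xv.
apply: nxy; apply: (agree_trans xv); apply: agree_sym.
by apply: agree_sub yv; lia.
Qed.

Lemma compact_cluster_seq Z (w : nat -> B) : compact Z -> (forall M, Z (w M)) ->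
  exists2 v, Z v & forall m, exists2 M, (m <= M)%N & agree (- m%:Z) m%:Z (w M) v.
Proof.
move=> cZ Zw; have [|v [Zv clv]] := cZ (w @ \oo) _; first by exists 0 => //= n _; exact: Zw.
exists v => // m.
have [y [[M mM <-] yv]] : [set w M | M in [set M | (m <= M)%N]] `&`
    [set y | agree (- m%:Z) m%:Z v y] !=set0.
  apply: clv; first by exists m => //= M mM; exists M.
  by apply: open_nbhs_nbhs; split; [exact: open_agree|].
by exists M => //; exact: agree_sym.
Qed.

Lemma compact_subcover Z (I : choiceType) (D : set I) (U : I -> set B) : compact Z ->
  (forall i, D i -> open (U i)) -> Z `<=` \bigcup_(i in D) U i ->
  exists s : seq I, [/\ uniq s, forall i, i \in s -> D i &
    forall y, Z y -> exists2 i, i \in s & U i y].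
Proof.
move=> cZ oU ZU; have [->|/set0P[w0 Zw]] := eqVneq Z set0.
  by exists [::]; split => // y [].
(* [compact_cover] is applied over a pointed space. [A] may be empty, so the base point is taken
   from [Z]. *)
pose T : ptopologicalType := HB.pack B (isPointed.Build B w0).
have := @compact_cover T; move=> /(congr1 (fun P => P Z)) cE.
have : @compact T Z by [].
rewrite cE => /(_ I D U oU ZU) [D' D'D ZD']; exists (finmap.enum_fset D').
split=> [|i iD|y /ZD'[i]].
- exact: finmap.fset_uniq.
- by have := D'D _ iD; rewrite inE.
- by exists i.
Qed.

End Sequences.

(** * Words and the mass of covers by cylinders *)

Section Content.
Variables (R : realType) (A : finType).
Local Notation B := (biseq R A).
Implicit Types x y w v : B.
Implicit Types X Y Z K : set B.

Definition word (a : int) (l : nat) w : {ffun 'I_l -> A} := [ffun i : 'I_l => w (a + (i : nat)%:Z)].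

Lemma word_eqP a l x y : word a l x = word a l y <-> agree a (a + l%:Z) x y.
Proof.
split=> [/ffunP xy k ak kl|xy]; last first.
  by apply/ffunP => i; rewrite !ffunE; apply: xy; have := ltn_ord i; lia.
have kl' : (absz (k - a) < l)%N by lia.
by have := xy (Ordinal kl'); rewrite !ffunE /= (_ : a + _ = k) //; lia.
Qed.

Definition lang Z l : {set {ffun 'I_l -> A}} :=
  [set u | `[< exists2 x, Z x & word 0 l x = u >]].

Lemma langP Z l u : reflect (exists2 x, Z x & word 0 l x = u) (u \in lang Z l).
Proof. by rewrite inE; exact: asboolP. Qed.

(** Independence of the free blocks. Finitely many blocks are prescribed at a time, which is all
    that a finite subcover can see. *)
Definition rich K (fr : int -> Prop) (L l : nat) (V : {set {ffun 'I_l -> A}}) :=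
  forall (Bd : nat) (u : int -> {ffun 'I_l -> A}), (forall j, u j \in V) ->
  exists2 w, K w &
    forall j : int, - Bd%:Z <= j < Bd%:Z -> fr j -> word (j * L%:Z) l w = u j.

(** Position [p] stands for block [p - Bd]. [S] lies in a product with a singleton factor at each
    position coming from [J]; restoring a factor #|V| at each of them gives at most the full
    product. *)
Lemma card_prescribed (Bd : nat) (U : finType) (V : {set U}) (J : seq int)
    (S : {set {ffun 'I_(Bd + Bd) -> U}}) (g : int -> U) :
  uniq J -> (forall j, j \in J -> - Bd%:Z <= j < Bd%:Z) ->
  (forall e p, e \in S -> e p \in V) ->
  (forall e (p : 'I_(Bd + Bd)), e \in S -> (p : nat)%:Z - Bd%:Z \in J ->
    e p = g ((p : nat)%:Z - Bd%:Z)) ->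
  (0 < #|V|)%N ->
  (#|S| * #|V| ^ size J <= #|V| ^ (Bd + Bd))%N.
Proof.
move=> uJ JB SV Sg V0; pose P (p : 'I_(Bd + Bd)) := (p : nat)%:Z - Bd%:Z \in J.
pose F p : {set U} := if P p then [set g ((p : nat)%:Z - Bd%:Z)]%SET else V.
have SF : (#|S| <= #|family F|)%N.
  apply/subset_leq_card/fintype.subsetP => e eS; apply/familyP => p; rewrite /F.
  by case: ifPn => [Pp|_]; rewrite ?inE ?(Sg e p eS Pp) // SV.
have cF : (#|family F| * #|V| ^ #|P| = #|V| ^ (Bd + Bd))%N.
  have -> : (#|family F| = \prod_(p < Bd + Bd) #|F p|)%N.
    by rewrite card_family foldrE big_map big_enum.
  rewrite -prod_nat_const [X in (_ * X)%N]big_mkcond /=.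
  rewrite -big_split /= (eq_bigr (fun=> #|V|)) ?prod_nat_const ?card_ord //.
  move=> p _; rewrite /F unfold_in -/(P p).
  by case: ifP => _; rewrite ?cards1 ?mul1n ?muln1.
rewrite -cF; apply: leq_mul => //; rewrite leq_pexp2l //.
have -> : size J = size (map (fun j => absz (j + Bd%:Z)) J) by rewrite size_map.
rewrite cardE -(size_map val); apply: uniq_leq_size => [|q].
  rewrite map_inj_in_uniq // => i j /JB iB /JB jB; lia.
case/mapP => j jJ ->; have jB := JB j jJ.
have jb : (absz (j + Bd%:Z)%R < Bd + Bd)%N by lia.
apply/mapP; exists (Ordinal jb) => //; rewrite mem_enum unfold_in /P /=.
by rewrite (_ : _ - _ = j) //; lia.
Qed.


(* Of the #|V|^(2 Bd) assignments of words to the blocks in [-Bd, Bd), at most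
   #|V|^(2 Bd - q) have their point of K in a given cylinder that fixes q free blocks. *)
Lemma content K (fr : int -> Prop) (L l : nat) (V : {set {ffun 'I_l -> A}})
    (D : set nat) (x : nat -> B) (a b : nat -> int) (J : nat -> seq int) :
  compact K -> rich K fr L V -> (0 < #|V|)%N -> (l <= L)%N ->
  (forall i, D i -> uniq (J i)) ->
  (forall i j, D i -> j \in J i ->
    [/\ fr j, a i <= j * L%:Z & (j + 1) * L%:Z <= b i]) ->
  K `<=` \bigcup_(i in D) [set y | agree (a i) (b i) (x i) y] ->
  (1 <= \esum_(i in D) ((#|V|%:R^-1 : R) ^+ size (J i))%:E)%E.
Proof.
move=> cK rK V0 lL uJ JP KD.
have [s [us sD Ks]] := compact_subcover cK (fun i _ => @open_agree R A _ _ _) KD.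
apply: esum_ge; exists [set` s].
  by split=> [|i /= /sD //]; exact: finite_seq.
rewrite -fsbig_seq // sumEFin lee_fin.
(* Any number above all |j| occurring in the finite subcover would do. *)
pose Bd := (\sum_(i <- s) \sum_(j <- J i) (absz j).+1)%N.
have BdP i j : i \in s -> j \in J i -> - Bd%:Z <= j < Bd%:Z.
  move=> iS jJ; have : (absz j < Bd)%N; last by lia.
  rewrite /Bd (big_rem i) //= (big_rem j) //=.
  by rewrite -addnA; exact: leq_addr.
have [u0 u0V] : exists u0, u0 \in V by apply/set0Pn; rewrite -card_gt0.
(* Extends an assignment on [-Bd, Bd) to all blocks by the default word [u0]. *)
pose u (e : {ffun 'I_(Bd + Bd) -> {ffun 'I_l -> A}}) (j : int) :=
  oapp e u0 (insub (absz (j + Bd%:Z))).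
have uV e : e \in ffun_on (mem V) -> forall j, u e j \in V.
  by move=> /ffun_onP eV j; rewrite /u; case: insubP => //= p _ _; exact: eV.
have : forall e, exists w, e \in ffun_on (mem V) -> K w /\
    forall j : int, - Bd%:Z <= j < Bd%:Z -> fr j -> word (j * L%:Z) l w = u e j.
  move=> e; case: (boolP (e \in ffun_on (mem V))) => [eV|_]; last first.
    by have [w _ _] := rK Bd (fun=> u0) (fun=> u0V); exists w.
  by have [w Kw wP] := rK Bd (u e) (uV e eV); exists w.
move=> /choice[y yP].
pose S i : {set {ffun 'I_(Bd + Bd) -> {ffun 'I_l -> A}}} :=
  [set e | (e \in ffun_on (mem V)) && `[< agree (a i) (b i) (x i) (y e) >]]%SET.
have cS i : i \in s -> (#|S i| * #|V| ^ size (J i) <= #|V| ^ (Bd + Bd))%N.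
  move=> iS; apply: (card_prescribed (g := fun j => word (j * L%:Z) l (x i))) => //.
  - exact/uJ/sD.
  - by move=> j /(BdP _ _ iS).
  - by move=> e p; rewrite inE => /andP[/ffun_onP /(_ p)].
  move=> e p; rewrite inE => /andP[eV /asboolP xy] pJ.
  have [frp ap pb] := JP _ _ (sD _ iS) pJ.
  have [Ky /(_ _ (BdP _ _ iS pJ) frp) yu] := yP e eV.
  transitivity (u e ((p : nat)%:Z - Bd%:Z)).
    rewrite /u subrK absz_nat; case: insubP => [q _ qp|]; last by rewrite ltn_ord.
    by congr (e _); apply: val_inj.
  rewrite -yu; apply/word_eqP; apply: agree_sym.
  by apply: agree_sub xy => //; lia.
(* Double counting: the point chosen for each assignment lies in some cylinder of the subcover. *)
have cE : (#|V| ^ (Bd + Bd) <= \sum_(i <- s) #|S i|)%N.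
  rewrite -[X in (_ ^ X)%N](card_ord (Bd + Bd)).
  rewrite -(card_ffun_on 'I_(Bd + Bd) (mem V)) -sum1_card.
  under [X in (_ <= X)%N]eq_bigr do rewrite -sum1_card big_mkcond /=.
  rewrite exchange_big /= [X in (X <= _)%N]big_mkcond /=.
  apply: leq_sum => e _; case: ifPn => // eV.
  have [Ky _] := yP e eV; have [i iS xy] := Ks _ Ky.
  by rewrite (big_rem i) //= inE eV /= asboolT.
have W0 : (0 : R) < #|V|%:R by rewrite ltr0n.
have : (\sum_(i <- s) (#|S i|)%:R : R) <=
    \sum_(i <- s) #|V|%:R ^+ (Bd + Bd) * (#|V|%:R^-1) ^+ size (J i).
  rewrite big_seq [leRHS]big_seq; apply: ler_sum => i iS.
  by rewrite exprVn ler_pdivlMr ?exprn_gt0 // -!natrX -natrM ler_nat cS.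
rewrite -mulr_sumr -natr_sum => /(le_trans _) h.
have : (#|V|%:R ^+ (Bd + Bd) : R) <=
    #|V|%:R ^+ (Bd + Bd) * \sum_(i <- s) (#|V|%:R^-1) ^+ size (J i).
  by apply: h; rewrite -natrX ler_nat.
by rewrite -[leLHS]mulr1 ler_pM2l // exprn_gt0.
Qed.

End Content.

(** * Entropy and dimension from bounds on covers *)

Section Dimensions.
Variables (R : realType) (T : metricType R).
Implicit Types (g : T -> T) (X Y Z : set T).

Lemma bowen_sum_ge0 X g s m e Z : (0 <= bowen_sum X g s m e Z)%E.
Proof.
apply: le_ereal_inf_tmp => _ [D [n [x [_ _ ->]]]].
by apply: esum_ge0 => i _; rewrite lee_fin expR_ge0.
Qed.

Lemma bowen_sum_homo X g s e Z :
  {homo bowen_sum X g s ^~ e ^~ Z : m m' / (m <= m')%N >-> (m <= m')%E}.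
Proof.
move=> m m' mm'; apply: le_ereal_inf => _ [D [n [x [DP ZD ->]]]].
exists D, n, x; split => // i /DP[Xi mi]; split => //; exact: leq_trans mi.
Qed.

Lemma bowen_sum_scale X g s m e e' Z : e <= e' ->
  (bowen_sum X g s m e' Z <= bowen_sum X g s m e Z)%E.
Proof.
move=> ee'; apply: le_ereal_inf => _ [D [n [x [DP ZD ->]]]].
exists D, n, x; split => // y /ZD[i Di [Xy xy]]; exists i => //; split => // j jn.
exact: lt_le_trans (xy j jn) ee'.
Qed.

Lemma bowen_measure_scale X g s e e' Z : e <= e' ->
  bowen_measure X g s e Z = 0%E -> bowen_measure X g s e' Z = 0%E.
Proof.
move=> ee' e0; apply/eqP; rewrite eq_le; apply/andP; split.
  rewrite -e0; apply: lee_lim.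
  - by apply: ereal_nondecreasing_is_cvgn; exact: bowen_sum_homo.
  - by apply: ereal_nondecreasing_is_cvgn; exact: bowen_sum_homo.
  - by apply: nearW => m; exact: bowen_sum_scale.
apply: lime_ge; first by apply: ereal_nondecreasing_is_cvgn; exact: bowen_sum_homo.
by apply: nearW => m; exact: bowen_sum_ge0.
Qed.

Lemma htop_scale_homo X g Z e e' : e <= e' ->
  (htop_scale X g Z e' <= htop_scale X g Z e)%E.
Proof.
move=> ee'; apply: le_ereal_inf => _ [s [s0 se] <-]; exists s => //; split => //.
exact: bowen_measure_scale se.
Qed.

Lemma is_cvg_htop X g Z : cvg (htop_scale X g Z e @[e --> 0^'+]).
Proof.
apply: nonincreasing_at_right_is_cvge; apply: nearW => x e e' _ _ ee'.
exact: htop_scale_homo.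
Qed.

Lemma htop_le X g Z (h : \bar R) :
  (forall e, 0 < e -> (htop_scale X g Z e <= h)%E) -> (htop X g Z <= h)%E.
Proof.
move=> H; apply: lime_le; first exact: is_cvg_htop.
by near=> e; apply: H.
Unshelve. all: by end_near. Qed.

(** A bound uniform in [m] keeps the Bowen measure positive at every exponent up to [s]. Only scales
    up to 1 matter for the limit, and for these a ball of length n fixes the coordinates [0, n). *)
Lemma htop_ge X g Z (s c : R) : 0 < c ->
  (forall t e m, 0 <= t <= s -> 0 < e <= 1 -> (c%:E <= bowen_sum X g t m e Z)%E) ->
  (s%:E <= htop X g Z)%E.
Proof.
move=> c0 H; apply: lime_ge; first exact: is_cvg_htop.
near=> e; have e01 : 0 < e <= 1.
  by apply/andP; split; near: e; [exact: nbhs_right_gt|exact: nbhs_right_le].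
apply: le_ereal_inf_tmp => _ [t [t0 te] <-]; rewrite lee_fin leNgt; apply/negP => ts.
have : (c%:E <= bowen_measure X g t e Z)%E.
  apply: lime_ge; first by apply: ereal_nondecreasing_is_cvgn; exact: bowen_sum_homo.
  by apply: nearW => m; apply: H; first by rewrite t0 ltW.
by rewrite te lee_fin leNgt c0.
Unshelve. all: by end_near. Qed.

Lemma htop_ge0 X g Z : (0 <= htop X g Z)%E.
Proof.
apply: lime_ge; first exact: is_cvg_htop.
apply: nearW => e; apply: le_ereal_inf_tmp => _ [s [s0 _] <-]; by rewrite lee_fin.
Qed.

Lemma htop_le_real X g Z (h : R) : 0 <= h ->
  (forall s e, h < s -> 0 < e -> forall c, 0 < c -> forall m,
     (bowen_sum X g s m e Z <= c%:E)%E) ->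
  (htop X g Z <= h%:E)%E.
Proof.
move=> h0 H; apply: htop_le => e e0; apply/lee_addgt0Pr => d d0.
apply: ereal_inf_lbound; exists (h + d); last by rewrite EFinD.
split; first by rewrite addr_ge0 // ltW.
rewrite /bowen_measure (_ : (fun m => _) = cst 0%E) ?lim_cst //.
apply/funext => m; apply/eqP; rewrite eq_le bowen_sum_ge0 andbT.
apply/lee_addgt0Pr => c c0; rewrite add0e.
by apply: H => //; rewrite ltrDl.
Qed.

Lemma hausdorff_premeasure_ge0 s d Z : (0 <= hausdorff_premeasure s d Z)%E.
Proof.
apply: le_ereal_inf_tmp => _ [D [U [_ _ ->]]].
by apply: esum_ge0 => i _; rewrite poweR_ge0.
Qed.

Lemma hausdorff_premeasure_homo s d d' Z : d <= d' ->
  (hausdorff_premeasure s d' Z <= hausdorff_premeasure s d Z)%E.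
Proof.
move=> dd'; apply: le_ereal_inf => _ [D [U [DP ZD ->]]].
exists D, U; split => // i /DP /le_trans; apply; by rewrite lee_fin.
Qed.

Lemma is_cvg_hausdorff s Z : cvg (hausdorff_premeasure s d Z @[d --> 0^'+]).
Proof.
apply: nonincreasing_at_right_is_cvge; apply: nearW => x e e' _ _ ee'.
exact: hausdorff_premeasure_homo.
Qed.

Lemma hausdorff_dim_ge Z (s : R) :
  (forall t, 0 <= t <= s -> exists2 c : R, 0 < c &
    forall d, (c%:E <= hausdorff_premeasure t d Z)%E) ->
  (s%:E <= hausdorff_dim Z)%E.
Proof.
move=> H; apply: le_ereal_inf_tmp => _ [t [t0 te] <-]; rewrite lee_fin leNgt.
apply/negP => ts; have [|c c0 cH] := H t; first by rewrite t0 ltW.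
have : (c%:E <= hausdorff_measure t Z)%E.
  by apply: lime_ge; [exact: is_cvg_hausdorff|apply: nearW => d; exact: cH].
by rewrite te lee_fin leNgt c0.
Qed.

Lemma hausdorff_dim_ge0 Z : (0 <= hausdorff_dim Z)%E.
Proof. by apply: le_ereal_inf_tmp => _ [s [s0 _] <-]; rewrite lee_fin. Qed.

Lemma hausdorff_dim_le Z (h : R) : 0 <= h ->
  (forall s d, h < s -> 0 < d -> forall c, 0 < c ->
     (hausdorff_premeasure s d Z <= c%:E)%E) ->
  (hausdorff_dim Z <= h%:E)%E.
Proof.
move=> h0 H; apply/lee_addgt0Pr => r r0.
apply: ereal_inf_lbound; exists (h + r); last by rewrite EFinD.
split; first by rewrite addr_ge0 // ltW.
apply/eqP; rewrite eq_le; apply/andP; split.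
  apply: lime_le; first exact: is_cvg_hausdorff.
  near=> d; apply/lee_addgt0Pr => c c0; rewrite add0e; apply: H => //.
  by rewrite ltrDl.
apply: lime_ge; first exact: is_cvg_hausdorff.
by apply: nearW => d; exact: hausdorff_premeasure_ge0.
Unshelve. all: by end_near. Qed.

End Dimensions.

(** * Weights and block counts for the lower bounds *)

Section LowerBounds.
Variables (R : realType) (A : finType).
Local Notation B := (biseq R A).
Implicit Types x y w v : B.
Implicit Types X Y Z K : set B.
Local Notation f := (@sigma_shift R A).

Lemma esumZ_le (D : set nat) (a : nat -> \bar R) (c : R) : 0 <= c ->
  (forall i, 0 <= a i)%E ->
  (\esum_(i in D) (c%:E * a i) <= c%:E * \esum_(i in D) a i)%E.
Proof.
move=> c0 a0; apply: ge_ereal_sup => _ [F [finF FD] <-].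
rewrite -ge0_mule_fsumr //; apply: lee_wpmul2l; first by rewrite lee_fin.
by apply: ereal_sup_ubound; exists F.
Qed.

Lemma esum_half_le (D : set nat) (c : R) : 0 <= c ->
  (\esum_(i in D) (c / (2 ^ i.+1)%:R)%:E <= c%:E)%E.
Proof.
move=> c0; have -> : D = [set i | (fun j => `[< D j >]) i].
  by apply/seteqP; split => i /asboolP.
rewrite -nneseries_esum; first exact: epsilon_trick0.
by move=> i _; rewrite lee_fin divr_ge0.
Qed.

(** Turns a number of blocks into an exponential weight; the [C] blocks lost to rounding cost only
    the constant factor [W ^+ C]. *)
Lemma expN_le_exp (W : R) (q C : nat) (t : R) : 1 <= W ->
  t <= (q + C)%:R * ln W -> W^-1 ^+ q <= W ^+ C * expR (- t).
Proof.
move=> W1 tq; have W0 : 0 < W by apply: lt_le_trans W1.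
rewrite -{1 2}(@lnK _ W) ?posrE // -expRN -!expRM_natl -expRD ler_expR.
by move: tq; rewrite natrD; lra.
Qed.

(** Block 0 is given up at the price of one unit, since the displacement by [c] may push it out of a
    cylinder that starts at 0. *)
Lemma count_density (fr : int -> Prop) (kappa : R) : 0 <= kappa <= 1 ->
  (forall M, kappa * M%:R <= (count (fun j : nat => `[< fr j%:Z >]) (iota 0 M))%:R) ->
  forall M, kappa * M%:R - 1 <= (count (fun j : nat => `[< fr j%:Z >]) (iota 1 M.-1))%:R.
Proof.
move=> /andP[k0 k1] H [|M]; first by rewrite mulr0 /= sub0r; lra.
have := H M.+1; rewrite /= natrD; case: asbool => /=; lra.
Qed.

End LowerBounds.

(** * Lower bounds from free blocks *)

(** The bound on [j] means (j + 2)L <= m: one extra block for the length of block j itself, one for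
    the displacement, as |c| <= L. *)
Lemma blocks_in_window (L m j : nat) (c : int) : (absz c <= L)%N ->
  (1 <= j < 1 + (m %/ L).-2)%N ->
  [/\ c <= j%:Z * L%:Z, (j%:Z + 1) * L%:Z <= m%:Z + c,
      - m%:Z + 1 + c <= - j%:Z * L%:Z & (- j%:Z + 1) * L%:Z <= m%:Z + c].
Proof.
move=> cL /andP[j1 jm]; have [L0|L0] := posnP L.
  by move: j1 jm; rewrite L0 divn0; clear; lia.
have mL := leq_trunc_div m L.
have jL : (L <= j * L)%N by rewrite leq_pmull.
have jmL : ((j + 2) * L <= m)%N.
  by apply: leq_trans mL; rewrite leq_mul2r; apply/orP; right; move: j1 jm; clear; lia.
rewrite mulnDl in jmL.
by split; rewrite ?mulrDl ?mulNr ?mul1r -?PoszM;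
  move: (j * L)%N L0 jL jmL cL => q; clear; lia.
Qed.

Section FreeBlocks.
Variables (R : realType) (A : finType).
Local Notation B := (biseq R A).
Implicit Types x y w v : B.
Implicit Types X Y Z K : set B.
Local Notation f := (@sigma_shift R A).

Variables (K Z : set B) (fr : int -> Prop) (L l : nat) (V : {set {ffun 'I_l -> A}}).
Variables (c : int) (kappa : R).
Hypotheses (cK : compact K) (rK : rich K fr L V) (V0 : (0 < #|V|)%N) (lL : (l <= L)%N).
Hypotheses (L0 : (0 < L)%N) (cL : (absz c <= L)%N) (k01 : 0 <= kappa <= 1).
Hypothesis dens : forall M,
  kappa * M%:R <= (count (fun j : nat => `[< fr j%:Z >]) (iota 0 M))%:R.
Hypothesis KZ : forall w, K w -> Z (shiftz c w).

Let W : R := #|V|%:R.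
Let W1 : 1 <= W. Proof. by rewrite /W ler1n. Qed.
Let lnW : 0 <= ln W. Proof. exact: ln_ge0. Qed.

Let pos M : seq int := [seq (j : nat)%:Z | j <- iota 1 M & `[< fr j%:Z >]].
(** Not filtered by [fr]: it serves where every negative block is free. *)
Let neg M : seq int := [seq - (j : nat)%:Z | j <- iota 1 M].

Let divL (n : nat) : n%:R / L%:R - 1 <= (n %/ L)%:R :> R.
Proof.
have Lr : (0 : R) < L%:R by rewrite ltr0n.
rewrite lerBlDr ler_pdivrMr // natr1 -natrM ler_nat.
by rewrite ltnW // ltn_ceil.
Qed.

(** A ball of length n fixes [c, n + c) in the coordinates of [K], hence about kappa n/L free
    blocks. The exponent 3 counts the losses: block 0, and at most two blocks by rounding. *)
Lemma bowen_sum_lower X (s e : R) (m : nat) : 0 <= s -> s * L%:R <= kappa * ln W ->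
  e <= 1 -> ((W^-1 ^+ 3)%:E <= bowen_sum X f s m e Z)%E.
Proof.
move=> s0 sL e1; apply: le_ereal_inf_tmp => _ [D [n [x [DP ZD ->]]]].
pose M i := (n i %/ L).-1.
have Lr : (0 : R) < L%:R by rewrite ltr0n.
have /(_ (fun i => shiftz (- c) (x i)) (fun=> c) (fun i => (n i)%:Z + c)
    (fun i => pos (M i).-1)) := @content R A K fr L l V D _ _ _ _ cK rK V0 lL.
move=> h; have {}h : (1 <= \esum_(i in D) (W^-1 ^+ size (pos (M i).-1))%:E)%E.
  apply: h.
  - move=> i _; rewrite map_inj_uniq ?filter_uniq ?iota_uniq //.
    by move=> j j' [].
  - move=> i j _ /mapP[j']; rewrite mem_filter mem_iota => /andP[/asboolP frj jM] ->.
    by have [] := blocks_in_window cL jM.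
  move=> w Kw; have [i Di xw] := ZD _ (KZ Kw); exists i => //=.
  by have /agree_shiftzr := dyn_ball_agree e1 xw; rewrite add0r.
rewrite -(@lee_pmul2l _ (W ^+ 3)%:E) ?lte_fin ?exprn_gt0 //; last first.
  by apply: lt_le_trans W1.
rewrite -EFinM -exprMn divff ?expr1n; last by rewrite gt_eqF // (lt_le_trans _ W1).
apply: (le_trans h).
apply: le_trans (esumZ_le _ _ _); last 2 first.
- by rewrite exprn_ge0 // (le_trans _ W1).
- by move=> i; rewrite lee_fin expR_ge0.
apply: le_esum => i _; rewrite -EFinM lee_fin mulNr; apply: expN_le_exp => //.
rewrite size_map size_filter.
have := count_density k01 dens (M i); set q := count _ _ => qM.
have Mn : (n i)%:R / L%:R - 2 <= (M i)%:R :> R.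
  have := divL (n i); rewrite /M; case: (n i %/ L)%N => [|k] /=; first lra.
  by rewrite -natr1; lra.
have : s * (n i)%:R <= kappa * ((n i)%:R / L%:R) * ln W.
  rewrite (_ : _ * ln W = kappa * ln W * (n i)%:R / L%:R); last by ring.
  rewrite ler_pdivlMr // (_ : _ * L%:R = s * L%:R * (n i)%:R); last by ring.
  by rewrite ler_wpM2r.
move=> /le_trans; apply; rewrite ler_wpM2r // natrD.
have [k0 k1] := andP k01.
apply: le_trans (_ : kappa * ((M i)%:R + 2) <= _); last by lra.
by rewrite ler_wpM2l //; lra.
Qed.

(* The error e is there because a one-point set has diameter 0. *)
Lemma diam_cylinder (U : set B) (w0 : B) (d s e : R) : (diam U <= d%:E)%E -> 0 <= s ->
  0 < e -> exists (x : B) (m : nat),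
    (forall y, U y -> agree (- m%:Z + 1) m%:Z x y) /\
    ((expR (- (s * m%:R)))%:E <= (expR s)%:E * poweR (diam U) s + e%:E)%E.
Proof.
move=> Ud s0 e0.
have D0 : (0 <= diam U)%E by apply: ereal_sup_ubound; left.
have Uxy x y : U x -> U y -> ((mdist x y)%:E <= diam U)%E.
  by move=> Ux Uy; apply: ereal_sup_ubound; right; exists (x, y).
have : diam U \is a fin_num by rewrite ge0_fin_numE // (le_lt_trans Ud) // ltry.
move=> /fineK; move: (fine _) => r rU; rewrite -rU in D0 Uxy *.
rewrite lee_fin in D0; rewrite poweR_EFin -EFinM -EFinD.
(* Diameter 0 determines no window. For s > 0 a large [m] makes the left side at most [e]; for s = 0
   the convention 0^0 = 1 pays for it. *)
have small : r = 0 -> exists m : nat, expR (- (s * m%:R)) <= expR s * r `^ s + e.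
  move=> ->; have [->|sn0] := eqVneq s 0.
    by exists 0%N; rewrite mul0r oppr0 powRr0 mulr1 lerDl ltW.
  have sp : 0 < s by rewrite lt_def sn0.
  exists (Num.truncn (- ln e / s)).+1; rewrite powR0 // mulr0 add0r.
  rewrite -[leRHS]lnK ?posrE // ler_expR lerNl mulrC -ler_pdivrMr //.
  by rewrite ltW // truncnS_gt.
have [[x Ux]|/set0P/negP/negPn/eqP U0] := pselect (U !=set0); last first.
  have r0 : r = 0.
    apply/eqP; rewrite eq_le D0 andbT -lee_fin rU; apply: ge_ereal_sup => t [->//|].
    by case=> -[x y] [/= Ux _] _; rewrite U0 in Ux.
  by have [m mP] := small r0; exists w0, m; split => // y; rewrite U0.
have [r0|rn0] := eqVneq r 0.
  have [m mP] := small r0; exists x, m; split => // y Uy.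
  have := Uxy _ _ Ux Uy; rewrite r0 lee_fin => xy.
  have -> : y = x by apply/esym/mdist_positivity/eqP; rewrite eq_le xy mdist_ge0.
  by [].
have rp : 0 < r by rewrite lt_def rn0.
(* Rounding -ln r down costs the factor e^s. If the result is 0, the window is empty. *)
exists x, (Num.truncn (- ln r)); split.
  move=> y Uy; case: (ltnP 0 (Num.truncn (- ln r))) => [m0|]; last first.
    by rewrite leqn0 => /eqP -> k k1 k2; exfalso; move: k1 k2; clear; lia.
  apply: (@mdist_le_agree R A (- ln r)); first by rewrite opprK lnK ?posrE // -lee_fin Uxy.
  by rewrite truncn_le; move: m0; rewrite truncn_gt0; apply: le_trans.
rewrite lee_fin; apply: le_trans (_ : expR s * r `^ s <= _); last by rewrite lerDl ltW.
rewrite /powR (negbTE rn0) -expRD ler_expR.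
have := truncnS_gt (- ln r); rewrite -natr1 => h.
have : s * - ln r <= s * ((Num.truncn (- ln r))%:R + 1) by rewrite ler_wpM2l // ltW.
lra.
Qed.

(** A set of diameter about e^(-m) fixes a symmetric window. All blocks on its negative side are
    free, which adds 1 to [kappa]; at most 6 blocks are lost at the ends and by rounding. *)
Lemma hausdorff_premeasure_lower (s : R) : (forall j, j < 0 -> fr j) ->
  0 <= s -> s * L%:R <= (1 + kappa) * ln W ->
  exists2 e : R, 0 < e & forall d, (e%:E <= hausdorff_premeasure s d Z)%E.
Proof.
move=> frN s0 sL; have W0 : 0 < W := lt_le_trans ltr01 W1.
have W6 : 0 < W ^+ 6 by rewrite exprn_gt0.
(* The errors e / 2^(i+1) from [diam_cylinder] add up to at most [e], so half of the mass 1 is left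
   for the diameters. *)
pose e := (W ^+ 6)^-1 / 2; have e0 : 0 < e by rewrite divr_gt0 // invr_gt0.
exists (e * expR (- s)); first by rewrite mulr_gt0 // expR_gt0.
move=> d; apply: le_ereal_inf_tmp => _ [D [U [DP ZD ->]]].
have Lr : (0 : R) < L%:R by rewrite ltr0n.
have [v0V v0] : exists u0, u0 \in V by apply/set0Pn; rewrite -card_gt0.
have [w0 _ _] := rK 0 (fun=> v0).
have /choice[xm xmP] : forall i, exists xm : B * nat, D i ->
    (forall y, U i y -> agree (- xm.2%:Z + 1) xm.2%:Z xm.1 y) /\
    ((expR (- (s * xm.2%:R)))%:E <=
       (expR s)%:E * poweR (diam (U i)) s + (e / (2 ^ i.+1)%:R)%:E)%E.
  move=> i; have [Di|nDi] := pselect (D i); last by exists (w0, 0%N).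
  have ei : 0 < e / (2 ^ i.+1)%:R by rewrite divr_gt0 // ltr0n expn_gt0.
  have [x [m P]] := diam_cylinder w0 (DP i Di) s0 ei.
  by exists (x, m).
pose m i := (xm i).2; pose M i := (m i %/ L).-1.
have /(_ (fun i => shiftz (- c) (xm i).1) (fun i => - (m i)%:Z + 1 + c) (fun i => (m i)%:Z + c)
    (fun i => pos (M i).-1 ++ neg (M i).-1)) := @content R A K fr L l V D _ _ _ _ cK rK V0 lL.
move=> h; have {}h : (1 <= \esum_(i in D) (W^-1 ^+ size (pos (M i).-1 ++ neg (M i).-1))%:E)%E.
  apply: h.
  - move=> i _; rewrite cat_uniq !map_inj_uniq ?filter_uniq ?iota_uniq //=; last 2 first.
    + by move=> j j' /oppr_inj [].
    + by move=> j j' [].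
    rewrite andbT; apply/hasPn => j /mapP[j']; rewrite mem_iota => jM ->.
    apply/negP => /mapP[j'']; rewrite mem_filter mem_iota => /andP[_ /andP[j''1 _]].
    by move: jM j''1 => /andP[+ _]; clear; lia.
  - move=> i j _; rewrite mem_cat => /orP[].
      move=> /mapP[j']; rewrite mem_filter mem_iota => /andP[/asboolP frj jM] ->.
      have [cj jc mc _] := blocks_in_window cL jM; split => //; apply: le_trans cj.
      rewrite -[leRHS]add0r lerD2r; move: jM => /andP[]; rewrite /M.
      move=> j1 jm; have : (0 < m i)%N; last by clear; lia.
      by case: (m i) jm j1 => //; rewrite div0n; clear; lia.
    move=> /mapP[j']; rewrite mem_iota => jM ->.
    have [_ _ mc jc] := blocks_in_window cL jM; split => //; apply: frN.
    by move: jM => /andP[+ _]; clear; lia.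
  move=> w Kw; have [i Di xw] := ZD _ (KZ Kw); exists i => //=.
  by apply/agree_shiftzr; have [/(_ _ xw)] := xmP i Di.
have {}h : (1 <= (W ^+ 6)%:E * \esum_(i in D) (expR (- (s * (m i)%:R)))%:E)%E.
  apply: (le_trans h).
  apply: le_trans (esumZ_le _ _ _); last 2 first.
  - exact: ltW.
  - by move=> i; rewrite lee_fin expR_ge0.
  apply: le_esum => i _; rewrite -EFinM lee_fin; apply: expN_le_exp => //.
  rewrite size_cat !size_map size_filter size_iota.
  have := count_density k01 dens (M i); set q := count _ _ => qM.
  have Mn : (m i)%:R / L%:R - 2 <= (M i)%:R :> R.
    have := divL (m i); rewrite /M; case: (m i %/ L)%N => [|k] /=; first lra.
    by rewrite -natr1; lra.
  have Mn' : (M i)%:R - 1 <= (M i).-1%:R :> R.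
    by case: (M i) => [|k] /=; [lra|rewrite -natr1; lra].
  have : s * (m i)%:R <= (1 + kappa) * ((m i)%:R / L%:R) * ln W.
    rewrite (_ : _ * ln W = (1 + kappa) * ln W * (m i)%:R / L%:R); last by ring.
    rewrite ler_pdivlMr // (_ : _ * L%:R = s * L%:R * (m i)%:R); last by ring.
    by rewrite ler_wpM2r.
  move=> /le_trans; apply; rewrite ler_wpM2r // !natrD.
  have [k0 k1] := andP k01.
  apply: le_trans (_ : (1 + kappa) * ((M i)%:R + 2) <= _); last by lra.
  by rewrite ler_wpM2l //; lra.
set S := (\esum_(i in D) poweR _ _)%E.
have S0 : (0 <= S)%E by apply: esum_ge0 => i _; exact: poweR_ge0.
have {}h : (1 <= (W ^+ 6)%:E * ((expR s)%:E * S + e%:E))%E.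
  apply: (le_trans h); apply: lee_wpmul2l; first by rewrite lee_fin ltW.
  apply: le_trans (_ : \esum_(i in D) ((expR s)%:E * poweR (diam (U i)) s +
    (e / (2 ^ i.+1)%:R)%:E) <= _)%E.
    by apply: le_esum => i Di; have [] := xmP i Di.
  rewrite esumD; last 2 first.
  - by move=> i _; rewrite mule_ge0 ?poweR_ge0 // lee_fin expR_ge0.
  - by move=> i _; rewrite lee_fin divr_ge0 // ltW.
  apply: leeD; last by apply: esum_half_le; exact: ltW.
  by apply: esumZ_le; [exact: expR_ge0|move=> i; exact: poweR_ge0].
move: S0 h; case: S => [S| |] // S0; last by rewrite leey.
rewrite (_ : (_ * (_ * _ + _))%E = (W ^+ 6 * (expR s * S + e))%:E) // !lee_fin => h.
have : e <= expR s * S.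
  have : W ^+ 6 * e = 1 / 2 by rewrite /e; field; rewrite gt_eqF.
  move=> We; rewrite mulrDr We in h.
  rewrite -(ler_pM2l W6) We; lra.
by move=> es; rewrite expRN ler_pdivrMr ?expR_gt0 // mulrC.
Qed.

End FreeBlocks.

(** * Covers of limsup sets *)

Section Upper.
Variables (R : realType) (A : finType).
Local Notation B := (biseq R A).
Implicit Types x y w v : B.
Implicit Types X Y Z K : set B.
Local Notation f := (@sigma_shift R A).

Lemma geometric_tail (q : R) (n0 M : nat) : 0 <= q < 1 ->
  \sum_(0 <= n < M | (n0 <= n)%N) q ^+ n <= q ^+ n0 / (1 - q).
Proof.
move=> /andP[q0 q1]; have q1' : 0 < 1 - q by rewrite subr_gt0.
(* The closed form telescopes; [maxn M n0] makes it 0 while M <= n0. *)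
suff H : \sum_(0 <= n < M | (n0 <= n)%N) q ^+ n <= (q ^+ n0 - q ^+ maxn M n0) / (1 - q).
  apply: (le_trans H); apply: ler_wpM2r; first by rewrite invr_ge0 ltW.
  by rewrite gerBl exprn_ge0.
elim: M => [|M IH]; first by rewrite big_geq // max0n subrr mul0r.
rewrite big_mkcond big_nat_recr //= -big_mkcond /=.
case: leqP => [nM|Mn]; last first.
  by rewrite addr0; move: IH; rewrite !(maxn_idPr _) // ltnW.
apply: (le_trans (lerD IH (lexx _))).
rewrite (maxn_idPl nM) (maxn_idPl (leqW nM)) ler_pdivlMr // exprS.
by rewrite mulrDl divfK ?gt_eqF //; lra.
Qed.

Lemma esum_geometric (sz : nat -> nat) (w : nat -> R) (C q : R) (n0 : nat) :
  0 <= C -> 0 <= q < 1 -> (forall n, 0 <= w n) ->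
  (forall n, (n0 <= n)%N -> (sz n)%:R * w n <= C * q ^+ n) ->
  (\esum_(k in [set n | (n0 <= n)%N] `*`` (fun n => [set` iota 0 (sz n)]))
     (w k.1)%:E <= (C * (q ^+ n0 / (1 - q)))%:E)%E.
Proof.
move=> C0 q01 w0 H.
rewrite -(esum_esum (a := fun n _ => (w n)%:E)); last by move=> *; rewrite lee_fin.
rewrite -(nneseries_esum (P := fun m => (n0 <= m)%N)); last first.
  by move=> n _; apply: esum_ge0 => *; rewrite lee_fin.
apply: lime_le.
  by apply: is_cvg_nneseries_cond => n _ _; apply: esum_ge0 => *; rewrite lee_fin.
apply: nearW => M.
apply: le_trans (_ : ((\sum_(0 <= n < M | (n0 <= n)%N) C * q ^+ n)%R)%:E <= _)%E; last first.
  by rewrite lee_fin -mulr_sumr; apply: ler_wpM2l => //; exact: geometric_tail.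
rewrite -sumEFin; apply: lee_sum => n nn.
rewrite esum_fset; [|exact: finite_seq|by move=> *; rewrite lee_fin].
rewrite -fsbig_seq ?iota_uniq // sumEFin lee_fin.
have -> : iota 0 (sz n) = index_iota 0 (sz n) by rewrite /index_iota subn0.
by rewrite sumr_const_nat subn0 -mulr_natl H.
Qed.

(** The convergence half of Borel-Cantelli: the sets used from any time [n0] on still cover [Z], and
    their total weight is a geometric tail. *)
Lemma limsup_cover Z (E : nat -> seq B) (Q : nat -> B -> set B) (w : nat -> R) (C q : R)
    (n2 : nat) (z0 : B) :
  0 <= C -> 0 <= q < 1 -> (forall n, 0 <= w n) ->
  (forall n, (n2 <= n)%N -> (size (E n))%:R * w n <= C * q ^+ n) ->
  (forall x n0, Z x -> exists n v, [/\ (n0 <= n)%N, v \in E n & Q n v x]) ->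
  forall c n1, 0 < c -> exists (D : set nat) (nn : nat -> nat) (o : nat -> B),
    [/\ forall i, D i -> (n1 <= nn i)%N /\ o i \in E (nn i),
        Z `<=` \bigcup_(i in D) Q (nn i) (o i) &
        (\esum_(i in D) (w (nn i))%:E <= c%:E)%E].
Proof.
move=> C0 q01 w0 H ZE c n1 c0.
have [n0 [n0n Cn]] : exists n0, (maxn n1 n2 <= n0)%N /\ C * (q ^+ n0 / (1 - q)) <= c.
  have [q0 q1] := andP q01; have q1' : 0 < 1 - q by rewrite subr_gt0.
  have C1 : 0 < C + 1 by rewrite ltr_wpDl.
  have /cvgrPdist_lt/(_ (c * (1 - q) / (C + 1))) : (GRing.exp q : R^nat) @ \oo --> 0.
    by apply: cvg_expr; rewrite ger0_norm.
  rewrite divr_gt0 ?mulr_gt0 // => /(_ isT) [N _ NP].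
  exists (maxn (maxn n1 n2) N); split; first exact: leq_maxl.
  have := NP (maxn (maxn n1 n2) N) (leq_maxr _ _) => /=.
  rewrite sub0r normrN ger0_norm ?exprn_ge0 // mulrA ler_pdivrMr // ltr_pdivlMr //.
  set t := _ ^+ _ => tc; apply: le_trans (ltW tc).
  by rewrite mulrDr mulr1 mulrC lerDl exprn_ge0.
pose P := [set n | (n0 <= n)%N] `*`` (fun n => [set` iota 0 (size (E n))]).
(* Covers are indexed by subsets of nat, so the pairs (time, rank in [E]) are coded by [pickle]. *)
pose dec i : nat * nat := odflt (0%N, 0%N) (unpickle i).
have decK k : dec (pickle k) = k by rewrite /dec pickleK.
exists (pickle @` P), (fun i => (dec i).1), (fun i => nth z0 (E (dec i).1) (dec i).2).
split.
- move=> _ [[n j] [/= nn jn] <-]; rewrite decK /=; split; first by lia.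
  by apply: mem_nth; move: jn; rewrite mem_iota add0n => /andP[].
- move=> x Zx; have [n [v [nn vE Qx]]] := ZE x n0 Zx.
  exists (pickle (n, index v (E n))); last by rewrite decK /= nth_index.
  exists (n, index v (E n)) => //; split => //=.
  by rewrite mem_iota /= add0n index_mem.
rewrite esum_image; last by move=> k k' _ _ /(congr1 dec); rewrite !decK.
under eq_esum do rewrite decK.
apply: le_trans (esum_geometric C0 q01 w0 _) _; last by rewrite lee_fin; exact: Cn.
by move=> n nn; apply: H; lia.
Qed.

End Upper.

(** * Upper bounds for entropy and dimension of limsup sets *)

Section UpperBounds.
Variables (R : realType) (A : finType).
Local Notation B := (biseq R A).
Variable b0 : B.
Implicit Types x y w v : B.
Implicit Types X Y Z K : set B.
Local Notation f := (@sigma_shift R A).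

Lemma word_shiftz a c l x : word a l (shiftz c x) = word (a + c) l x.
Proof. by apply/ffunP => i; rewrite !ffunE /shiftz addrAC. Qed.

(** Representatives are taken inside [P], so that they also share the coordinates which [P]
    prescribes outside the word. *)
Lemma word_representatives X (P : set B) (a : int) (l : nat) :
  (forall c w, X w -> X (shiftz c w)) -> P `<=` X ->
  exists E : seq B, [/\ (size E <= #|lang X l|)%N, forall v, v \in E -> P v &
    forall x, P x -> exists2 v, v \in E & word a l v = word a l x].
Proof.
move=> Xs PX; pose V := [set u : {ffun 'I_l -> A} | `[< exists2 x, P x & word a l x = u >]]%SET.
have /choice[g gP] : forall u, exists x, u \in V -> P x /\ word a l x = u.
  move=> u; have [[x Px xu]|nP] := pselect (exists2 x, P x & word a l x = u).
    by exists x.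
  by exists b0; rewrite inE => /asboolP.
exists [seq g u | u <- enum V]; split.
- rewrite size_map -cardE; apply/subset_leq_card/fintype.subsetP => u.
  rewrite inE => /asboolP[x Px xu]; apply/langP; exists (shiftz a x); first exact/Xs/PX.
  by rewrite word_shiftz add0r.
- by move=> v /mapP[u]; rewrite mem_enum => /gP[Pu _] ->.
move=> x Px; have xV : word a l x \in V by rewrite inE; apply/asboolP; exists x.
exists (g (word a l x)); first by apply/mapP; exists (word a l x); rewrite ?mem_enum.
by have [] := gP _ xV.
Qed.

Lemma diam_agree (m : nat) x :
  (diam [set y | agree (- m%:Z) m%:Z x y] <= (expR (- m%:R))%:E)%E.
Proof.
apply: ge_ereal_sup => a [->|]; first by rewrite lee_fin expR_ge0.
move=> [[y v] [/= xy xv] <-] /=; rewrite lee_fin; apply: agree_mdist_le.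
exact: agree_trans (agree_sym xy) xv.
Qed.

Variables (X Z : set B) (C h t : R) (z : nat -> B).
Hypothesis Xs : forall c w, X w -> X (shiftz c w).
Hypotheses (C0 : 0 <= C) (h0 : 0 <= h) (t0 : 0 <= t).
Hypothesis XC : forall M, (#|lang X M|)%:R <= C * expR (h * M%:R).
Let r (n : nat) := Num.truncn (t * n%:R).
Hypothesis ZX : Z `<=` X.
Hypothesis Zz : forall x (n0 : nat), Z x -> exists2 n, (n0 <= n)%N &
  agree (- (r n)%:Z) (r n)%:Z (shiftz n%:Z x) (z n).

Let P n := [set x | X x /\ agree (- (r n)%:Z) (r n)%:Z (shiftz n%:Z x) (z n)].

Let rP n : (r n)%:R <= t * n%:R < (r n)%:R + 1.
Proof. by rewrite natr1 truncn_itv // mulr_ge0. Qed.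

Let Pagree n x y : P n x -> P n y -> agree (n%:Z - (r n)%:Z) (n%:Z + (r n)%:Z) x y.
Proof.
move=> [_ xz] [_ yz]; have := agree_trans xz (agree_sym yz).
by move/agree_shiftz; apply: agree_sub; lia.
Qed.

Let expR_lt1 (d : R) : 0 < d -> 0 <= expR (- d) < 1.
Proof. by move=> d0; rewrite expR_ge0 -expR0 ltr_expR oppr_lt0. Qed.

(** Agreement on [-k, n + r) suffices for a ball of length n + r - k at scale e^(-k). As [n - r, n +
    r) is prescribed, a word on [-k, n - r) selects the ball: about e^(h(1-t)n) balls of weight
    about e^(-s(1+t)n), summable for s > h(1-t)/(1+t). *)
Lemma htop_upper : t < 1 -> (htop X f Z <= ((1 - t) / (1 + t) * h)%:E)%E.
Proof.
move: (t0) (h0) (C0) => t0' h0' C0' t1; have tp : 0 < 1 + t by lra.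
apply: htop_le_real; first by rewrite mulr_ge0 // divr_ge0 //; lra.
move=> s e hs e0 c c0 m.
have s0 : 0 < s by apply: le_lt_trans hs; rewrite mulr_ge0 // divr_ge0 //; lra.
have [k ke] : exists k : nat, expR (- k%:R) <= e.
  exists (Num.truncn (- ln e)).+1.
  by rewrite -[leRHS]lnK ?posrE // ler_expR lerNl ltW // truncnS_gt.
have /choice[E EP] : forall n, exists E : seq B, [/\ (size E <= #|lang X (n + k - r n)|)%N,
    forall v, v \in E -> P n v &
    forall x, P n x -> exists2 v, v \in E &
      word (- k%:Z) (n + k - r n) v = word (- k%:Z) (n + k - r n) x].
  by move=> n; apply: word_representatives => // x [].
pose len n := (n + r n - k)%N.
have rn n : (r n <= n)%N.
  have /andP[rt _] := rP n; rewrite -(ler_nat R); apply: (le_trans rt).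
  by rewrite ler_piMl // ltW.
(* The rate of the geometric series; the factor e^((h+s)(k+1)) below absorbs the scale [k] and the
   rounding of tn to [r n]. *)
pose d := s * (1 + t) - h * (1 - t).
have d0 : 0 < d.
  rewrite subr_gt0; move: hs; rewrite mulrAC ltr_pdivrMr // mulrC; lra.
have [D [nn [b [DP ZD Dc]]]] : exists (D : set nat) (nn : nat -> nat) (b : nat -> B),
    [/\ forall i, D i -> (m + k <= nn i)%N /\ b i \in E (nn i),
        Z `<=` \bigcup_(i in D) dyn_ball X f (len (nn i)) (b i) e &
        (\esum_(i in D) (expR (- s * (len (nn i))%:R))%:E <= c%:E)%E].
  apply: (@limsup_cover R A Z E (fun n v => dyn_ball X f (len n) v e)
    (fun n => expR (- s * (len n)%:R)) (C * expR ((h + s) * (k%:R + 1))) (expR (- d)) k b0) => //.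
  - by rewrite mulr_ge0 // expR_ge0.
  - exact: expR_lt1.
  - move=> n kn; have [Esz _ _] := EP n.
    apply: le_trans (_ : C * expR (h * (n + k - r n)%N%:R) * expR (- s * (len n)%:R) <= _).
      apply: ler_wpM2r; first exact: expR_ge0.
      by apply: le_trans (XC _); rewrite ler_nat.
    rewrite -mulrA -mulrA; apply: ler_wpM2l => //.
    rewrite -expRD -expRM_natl -expRD ler_expR /len (natrB _ (leq_trans (rn n) (leq_addr _ _))).
    rewrite (natrB _ (leq_trans kn (leq_addr _ _))) !natrD.
    have /andP[r1 r2] := rP n; rewrite /d; nra.
  move=> x n0 Zx; have [n n0n xz] := Zz (maxn n0 k) Zx.
  have [_ Ev Ex] := EP n; have Px : P n x by split => //; exact: ZX.
  have [v vE vx] := Ex x Px; exists n, v; split => //.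
    by apply: leq_trans n0n; exact: leq_maxl.
  apply: (agree_dyn_ball ke); first exact: ZX.
  have /word_eqP vx1 := vx; have vx2 := Pagree (Ev v vE) Px.
  move=> a ak an; have rnn := rn n; have [al|ar] := ltP a (n%:Z - (r n)%:Z).
    by apply: vx1; clear - ak al rnn; lia.
  have kn : (k <= n)%N by apply: leq_trans n0n; exact: leq_maxr.
  by apply: vx2; move: an; rewrite /len => an; clear - an ar kn; lia.
apply: le_trans Dc; apply: ereal_inf_lbound; exists D, (fun i => len (nn i)), b.
split => // i /DP[mi oE]; have [_ Ev _] := EP (nn i).
split; first by have [] := Ev _ oE.
by rewrite /len -(addnK k m) leq_sub2r // (leq_trans mi) // leq_addr.
Qed.

(** Common to both dimension bounds: the cover consists of cylinders on [-len, len), whose diameters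
    fall below [d] once [len] is large. *)
Let hausdorff_cover (s d c K q : R) (E : nat -> seq B) (len : nat -> nat) (n2 : nat) :
  0 < s -> 0 < d -> 0 < c -> 0 <= K -> 0 <= q < 1 ->
  (forall n, (n2 <= n)%N -> (size (E n))%:R * expR (- s * (len n)%:R) <= K * q ^+ n) ->
  (forall M, exists n1, forall n, (n1 <= n)%N -> (M <= len n)%N) ->
  (forall n x, (n2 <= n)%N -> P n x -> exists2 v, v \in E n &
     agree (- (len n)%:Z) (len n)%:Z v x) ->
  (hausdorff_premeasure s d Z <= c%:E)%E.
Proof.
move=> s0 d0 c0 K0 q01 H lenoo cov.
have [n1 n1P] := lenoo (Num.truncn (- ln d)).+1.
have [D [nn [b [DP ZD Dc]]]] : exists (D : set nat) (nn : nat -> nat) (b : nat -> B),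
    [/\ forall i, D i -> (n1 <= nn i)%N /\ b i \in E (nn i),
        Z `<=` \bigcup_(i in D) [set y | agree (- (len (nn i))%:Z) (len (nn i))%:Z (b i) y] &
        (\esum_(i in D) (expR (- s * (len (nn i))%:R))%:E <= c%:E)%E].
  apply: (@limsup_cover R A Z E (fun n v => [set y | agree (- (len n)%:Z) (len n)%:Z v y])
    (fun n => expR (- s * (len n)%:R)) K q n2 b0) => //.
  move=> x n0 Zx; have [n n0n xz] := Zz (maxn n0 n2) Zx.
  have [| |v vE vx] := cov n x; [|by split => //; exact: ZX|].
    by apply: leq_trans n0n; exact: leq_maxr.
  by exists n, v; split => //; apply: leq_trans n0n; exact: leq_maxl.
apply: le_trans Dc; apply: le_trans (_ : \esum_(i in D) poweR
    (diam [set y | agree (- (len (nn i))%:Z) (len (nn i))%:Z (b i) y]) s <= _)%E.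
  apply: ereal_inf_lbound; exists D, (fun i => [set y |
    agree (- (len (nn i))%:Z) (len (nn i))%:Z (b i) y]); split => // i /DP[ni _].
  apply: (le_trans (diam_agree _ _)); rewrite lee_fin.
  rewrite -[leRHS]lnK ?posrE // ler_expR lerNl; apply: ltW.
  by apply: lt_le_trans (truncnS_gt _) _; rewrite ler_nat n1P.
apply: le_esum => i _.
apply: le_trans (_ : poweR (expR (- (len (nn i))%:R))%:E s <= _)%E.
  apply: gt0_ler_poweR; [exact: ltW| | |exact: diam_agree].
  - by rewrite in_itv /= leey andbT; apply: ereal_sup_ubound; left.
  - by rewrite in_itv /= leey andbT lee_fin expR_ge0.
by rewrite poweR_EFin lee_fin /powR gt_eqF ?expR_gt0 // expRK mulrN mulNr.
Qed.

(** The word on [-(n + r), n - r) has length 2n whatever r is, and the window supplies the rest up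
    to n + r: about e^(2hn) cylinders of diameter at most e^(-(n+r)). *)
Lemma hausdorff_dim_upper : (hausdorff_dim Z <= (2 / (1 + t) * h)%:E)%E.
Proof.
move: (t0) (h0) (C0) => t0' h0' C0'; have tp : 0 < 1 + t by lra.
apply: hausdorff_dim_le; first by rewrite mulr_ge0 // divr_ge0 //; lra.
move=> s d hs d0 c c0.
have s0 : 0 < s by apply: le_lt_trans hs; rewrite mulr_ge0 // divr_ge0 //; lra.
have /choice[E EP] : forall n, exists E : seq B, [/\ (size E <= #|lang X (n + n)|)%N,
    forall v, v \in E -> P n v &
    forall x, P n x -> exists2 v, v \in E &
      word (- (n + r n)%N%:Z) (n + n) v = word (- (n + r n)%N%:Z) (n + n) x].
  by move=> n; apply: word_representatives => // x [].
pose e := s * (1 + t) - h * 2.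
have e0 : 0 < e.
  rewrite subr_gt0; move: hs; rewrite mulrAC ltr_pdivrMr // mulrC; lra.
apply: (@hausdorff_cover s d c (C * expR s) (expR (- e)) E (fun n => n + r n)%N 0) => //.
- by rewrite mulr_ge0 // expR_ge0.
- exact: expR_lt1.
- move=> n _; have [Esz _ _] := EP n.
  apply: le_trans (_ : C * expR (h * (n + n)%N%:R) * expR (- s * (n + r n)%N%:R) <= _).
    apply: ler_wpM2r; first exact: expR_ge0.
    by apply: le_trans (XC _); rewrite ler_nat.
  rewrite -mulrA -mulrA; apply: ler_wpM2l => //.
  rewrite -expRD -expRM_natl -expRD ler_expR !natrD.
  have /andP[r1 r2] := rP n; rewrite /e; nra.
- by move=> M; exists M => n /leq_trans; apply; exact: leq_addr.
move=> n x _ Px; have [_ Ev Ex] := EP n.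
have [v vE vx] := Ex x Px; exists v => //.
have /word_eqP vx1 := vx; have vx2 := Pagree (Ev v vE) Px.
move=> a ak an; have [al|ar] := ltP a (n%:Z - (r n)%:Z).
  by apply: vx1; clear - ak al; lia.
by apply: vx2; clear - an ar; lia.
Qed.

(** For t > 1 the prescribed window eventually contains the symmetric one of radius r - n about 0.
    Words of length 0 then suffice, and every exponent s > 0 gives a convergent series of ratio
    e^(-s(t-1)). *)
Lemma hausdorff_dim_eq0 : 1 < t -> hausdorff_dim Z = 0%E.
Proof.
move: (t0) (h0) (C0) => t0' h0' C0' t1.
apply/eqP; rewrite eq_le hausdorff_dim_ge0 andbT.
apply: hausdorff_dim_le => // s d s0 d0 c c0.
have /choice[E EP] : forall n, exists E : seq B, [/\ (size E <= #|lang X 0|)%N,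
    forall v, v \in E -> P n v &
    forall x, P n x -> exists2 v, v \in E & word 0 0 v = word 0 0 x].
  by move=> n; apply: word_representatives => // x [].
have rn n : t * n%:R - n%:R - 1 <= (r n - n)%N%:R.
  have /andP[_ r2] := rP n; have [nr|rn] := leqP n (r n); first by rewrite natrB //; lra.
  have rn' : (r n)%:R <= n%:R :> R by rewrite ler_nat ltnW.
  rewrite (_ : (r n - n)%N = 0%N); last by apply/eqP; rewrite subn_eq0 ltnW.
  lra.
apply: (@hausdorff_cover s d c (C * expR s) (expR (- (s * (t - 1)))) E
  (fun n => r n - n)%N 0) => //.
- by rewrite mulr_ge0 // expR_ge0.
- by apply: expR_lt1; rewrite mulr_gt0 // subr_gt0.
- move=> n _; have [Esz _ _] := EP n.
  apply: le_trans (_ : C * expR (- s * (r n - n)%N%:R) <= _).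
    apply: ler_wpM2r; first exact: expR_ge0.
    by have := XC 0; rewrite mulr0 expR0 mulr1; apply: le_trans; rewrite ler_nat.
  rewrite -mulrA; apply: ler_wpM2l => //.
  rewrite -expRM_natl -expRD ler_expR.
  by have := rn n; nra.
- move=> M; exists (Num.truncn ((M%:R + 1) / (t - 1))).+1 => n Mn.
  rewrite -(ler_nat R); apply: le_trans (rn n).
  have : (M%:R + 1) / (t - 1) <= n%:R.
    by apply: ltW; apply: lt_le_trans (truncnS_gt _) _; rewrite ler_nat.
  by rewrite ler_pdivrMr ?subr_gt0 //; lra.
move=> n x _ Px; have [_ Ev Ex] := EP n.
have [v vE _] := Ex x Px; exists v => //.
by move=> a an ar; apply: (Pagree (Ev v vE) Px); clear - an ar; lia.
Qed.

End UpperBounds.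

(** * Specification and forced windows *)

Section Specification.
Variables (R : realType) (A : finType).
Local Notation B := (biseq R A).
Implicit Types x y w v : B.
Local Notation f := (@sigma_shift R A).

(* The specification property of sigma^N at the single scale e^(-N), for which closeness
   of sigma^N-orbits forces agreement on all the coordinates in between. *)
Definition gluing (Y : set B) (N : nat) (p : nat -> nat) : Prop :=
  forall (k : nat) (x : 'I_k -> B) (n q : 'I_k -> nat), (0 < k)%N ->
    (forall i, Y (x i)) -> (forall i, (0 < n i)%N) -> (forall i, (p (n i) <= q i)%N) ->
    exists2 z, Y z & forall i : 'I_k, dyn_ball Y (iter N f) (n i) (x i) (expR (- N%:R))
      (iter (\sum_(j < k | (j < i)%N) (n j + q j))%N (iter N f) z).

Variables (Y : set B) (N : nat) (p : nat -> nat).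
Hypotheses (Yne : Y !=set0) (cY : compact Y) (N0 : (0 < N)%N).
Hypothesis YN : iter N f @` Y = Y.
Hypothesis specY : gluing Y N p.

(** Places segments at the prescribed positions i b. Positions with [None] are absorbed into the
    gaps, which specification allows to exceed [p], and the resulting point is shifted back by the
    first occupied position. *)
Lemma spec_blocks (b : nat) (sg : nat -> option (B * nat)) (M : nat) :
  (forall i v n, sg i = Some (v, n) -> Y v /\ (0 < n)%N) ->
  (forall i i' v n v' n', (i < i')%N -> sg i = Some (v, n) -> sg i' = Some (v', n') ->
    (i * b + n + p n <= i' * b)%N) ->
  exists2 w, Y w & forall i v n, (i < M)%N -> sg i = Some (v, n) ->
    agree (i * b * N)%N%:Z ((i * b + n) * N)%N%:Z (shiftz (- (i * b * N)%N%:Z) v) w.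
Proof.
move=> sgY sgb; have [y0 Yy0] := Yne.
pose S := [seq i <- iota 0 M | isSome (sg i)]; pose k := size S.
have Ssome j : (j < k)%N -> sg (nth 0%N S j) = Some (odflt (y0, 1%N) (sg (nth 0%N S j))).
  move=> jk; have : nth 0%N S j \in S by exact: mem_nth.
  by rewrite mem_filter; case: (sg _) => // vn.
have Slt j j' : (j < j')%N -> (j' < k)%N -> (nth 0%N S j < nth 0%N S j')%N.
  move=> jj' j'k; apply: (sorted_ltn_nth ltn_trans) => //.
  - by apply: sorted_filter; [exact: ltn_trans|exact: iota_ltn_sorted].
  - by rewrite inE (ltn_trans jj').
have [k0|k0] := posnP k.
  exists y0 => // i v n iM si; have : i \in S by rewrite mem_filter si mem_iota.
  by move/size0nil : k0; rewrite /k => ->.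
pose x j := (odflt (y0, 1%N) (sg (nth 0%N S j))).1.
pose n j := (odflt (y0, 1%N) (sg (nth 0%N S j))).2.
pose t j := (nth 0%N S j * b)%N.
(* Exact distance to the next segment; after the last one, any admissible gap will do. *)
pose q j := if (j.+1 < k)%N then (t j.+1 - t j - n j)%N else p (n j).
have sgS j : (j < k)%N -> sg (nth 0%N S j) = Some (x j, n j).
  by move=> jk; rewrite Ssome // /x /n; case: (odflt _ _).
have tn j : (j.+1 < k)%N -> (t j + n j + p (n j) <= t j.+1)%N.
  by move=> jk; apply: (sgb _ _ _ _ _ _ _ (sgS _ (ltnW jk)) (sgS _ jk)); exact: Slt.
have [| | |z Yz zP] := @specY k (fun j => x j) (fun j => n j) (fun j => q j) k0.
- by move=> j; have [] := sgY _ _ _ (sgS j (ltn_ord j)).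
- by move=> j; have [] := sgY _ _ _ (sgS j (ltn_ord j)).
- move=> j; rewrite /q; case: ifPn => // jk; have := tn j jk; clear; lia.
have sumE j : (j < k)%N -> (\sum_(i < j) (n i + q i) + t 0 = t j)%N.
  elim: j => [|j IH] jk; first by rewrite big_ord0.
  rewrite big_ord_recr /= addnAC IH ?(ltnW jk) // /q jk.
  by have := tn j jk; clear; lia.
exists (shiftz (- (N%:Z * (t 0%N)%:Z)) z).
  by rewrite -mulrN; exact: shiftz_stable.
move=> i v m iM si; have iS : i \in S by rewrite mem_filter si mem_iota.
have jk : (index i S < k)%N by rewrite index_mem.
have := sgS _ jk; rewrite nth_index // si => -[vE mE].
have := zP (Ordinal jk); rewrite /= -vE -mE.
rewrite -(big_ord_widen k (fun j => n j + q j)%N (ltnW jk)).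
have := sumE _ jk; set T := (\sum_(_ < _) _)%N; rewrite {2}/t nth_index // => TE.
rewrite iter_iter_shift => /(spec_ball_agree N0) /agree_shiftzr zv.
apply/agree_shiftzr; rewrite shiftzD.
have -> : - - (N%:Z * (t 0%N)%:Z) - (i * b * N)%N%:Z = - (T * N)%N%:Z.
  rewrite -TE; clear; lia.
by apply: agree_sub zv; rewrite -TE; clear; lia.
Qed.

Variables (I : set nat) (u v l : nat -> nat) (y : nat -> B) (n : nat).
Let b := (n + p n)%N.
Let L := (b * N)%N.
Hypotheses (n0 : (0 < n)%N) (Yy : forall k, I k -> Y (y k)).
Hypothesis l0 : forall k, I k -> (0 < l k)%N.
Hypothesis lb : forall k, I k -> (u k * b + l k + p (l k) <= v k * b)%N.
Hypothesis uv : forall k k', I k -> I k' -> (k < k')%N -> (v k <= u k')%N.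

(** Window [k] begins at block [u k]; the blocks before [v k] are given up to it and to the gap
    [p (l k)] behind it. *)
Definition free_block (j : int) := forall k, I k -> ~ ((u k)%:Z <= j < (v k)%:Z).

Definition window_set : set B := [set w | Y w /\ forall k, I k ->
  agree (u k * L)%N%:Z (u k * L + l k * N)%N%:Z (shiftz (- (u k * L)%N%:Z) (y k)) w].

Lemma compact_window_set : compact window_set.
Proof.
have -> : window_set = Y `&` \bigcap_(k in I) [set w |
    agree (u k * L)%N%:Z (u k * L + l k * N)%N%:Z (shiftz (- (u k * L)%N%:Z) (y k)) w].
  by [].
apply: compact_closedI => //; apply: closed_bigI => k _; exact: closed_agree.
Qed.

(** Blocks are numbered from -Bd to fit forward specification. For each [M] a point matches the
    first [M] positions, and a cluster point of these, shifted by Bd L, matches all windows and all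
    requested blocks. *)
Lemma rich_window_set : rich window_set free_block L (lang Y (n * N)).
Proof.
move=> Bd a aV.
have /choice[g gP] : forall j, exists g, Y g /\ word 0 (n * N) g = a j.
  by move=> j; have /langP[g Yg ga] := aV j; exists g.
have b0 : (0 < b)%N by rewrite /b addn_gt0 n0.
have uvk k : I k -> (u k < v k)%N.
  move=> Ik; rewrite -(ltn_pmul2r b0); apply: leq_trans (lb Ik).
  by rewrite -addnA -addn1 leq_add2l addn_gt0 l0.
pose blk (i : nat) : int := i%:Z - Bd%:Z.
(* A position carries the requested word if its block is free, the segment of a window if the window
   starts there, and nothing inside a window. *)
have /choice[sg sgP] : forall i : nat, exists o : option (B * nat),
    if pselect (free_block (blk i)) then o = Some (g (blk i), n)
    else if pselect (exists2 k, I k & (u k)%:Z = blk i) is left h then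
      exists k, [/\ I k, (u k)%:Z = blk i & o = Some (y k, l k)]
    else o = None.
  move=> i; case: pselect => h; first by exists (Some (g (blk i), n)).
  case: pselect => [[k Ik uk]|h']; last by exists None.
  by exists (Some (y k, l k)), k.
have sgI i x m : sg i = Some (x, m) -> (free_block (blk i) /\ (x, m) = (g (blk i), n)) \/
    exists k, [/\ I k, (u k)%:Z = blk i & (x, m) = (y k, l k)].
  move=> si; have := sgP i; case: pselect => /= [h|nh].
    by rewrite si => /Some_inj E; left.
  case: pselect => /= [h [k [Ik uk]]|h]; last by rewrite si.
  by rewrite si => /Some_inj E; right; exists k.
have sgF i : free_block (blk i) -> sg i = Some (g (blk i), n).
  by move=> h; have := sgP i; case: pselect.
have sgW k i : I k -> (u k)%:Z = blk i -> sg i = Some (y k, l k).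
  move=> Ik uk; have := sgP i; case: pselect => /= [h|nh].
    by exfalso; apply: (h k Ik); have := uvk k Ik; rewrite -uk; clear; lia.
  case: pselect => /= [h [k' [Ik' uk' ->]]|[]]; last by exists k.
  have ukk : u k = u k' by move: uk uk'; clear; lia.
  case: (ltngtP k k') => [kk|kk|->] //.
    by have := uv Ik Ik' kk; rewrite leqNgt -ukk uvk.
  by have := uv Ik' Ik kk; rewrite leqNgt ukk uvk.
have /choice[w wP] : forall M : nat, exists w, Y w /\ forall i x m, (i < M)%N ->
    sg i = Some (x, m) ->
    agree (i * b * N)%N%:Z ((i * b + m) * N)%N%:Z (shiftz (- (i * b * N)%N%:Z) x) w.
  move=> M; have [| |w Yw wP] := @spec_blocks b sg M; last by exists w.
  - move=> i x m /sgI[[_ [-> ->]]|[k [Ik _ [-> ->]]]].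
      by have [] := gP (blk i).
    by split; [exact: Yy|exact: l0].
  move=> i i' x m x' m' ii' /sgI[[_ [_ ->]]|[k [Ik uk [_ ->]]]] si'.
    by rewrite -addnA -/b -mulSnr leq_mul2r ii' orbT.
  have vi : (v k)%:Z <= blk i'.
    have [[fr _]|[k' [Ik' uk' _]]] := sgI _ _ _ si'.
      have := fr k Ik; move: uk ii'; rewrite /blk; clear => uk ii' H.
      rewrite leNgt; apply/negP => h; apply: H; rewrite h andbT uk; lia.
    case: (ltngtP k k') => [kk|kk|kk].
    - by rewrite -uk' lez_nat; exact: uv.
    - have := uv Ik' Ik kk; have := uvk _ Ik'.
      by move: uk uk' ii'; rewrite /blk; clear; lia.
    - by move: uk uk' ii'; rewrite kk /blk; clear; lia.
  have : ((u k + (i' - i)) * b >= v k * b)%N.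
    by rewrite leq_mul2r; apply/orP; right; move: uk vi ii'; rewrite /blk; clear; lia.
  have := lb Ik; rewrite mulnDl mulnBl => h1 h2.
  have h3 : (i * b <= i' * b)%N by rewrite leq_mul2r ltnW ?orbT.
  by move: h1 h2 h3; clear; lia.
have Yw M : Y (shiftz (Bd * L)%N%:Z (w M)).
  have -> : (Bd * L)%N%:Z = N%:Z * (Bd * b)%N%:Z by rewrite /L; clear; lia.
  by apply: shiftz_stable => //; have [] := wP M.
have [w0 Yw0 w0P] := compact_cluster_seq cY Yw.
have match_blk i x m : sg i = Some (x, m) ->
    agree (blk i * L%:Z) (blk i * L%:Z + (m * N)%N%:Z) (shiftz (- (blk i * L%:Z)) x) w0.
  move=> si; have [M Mm wM] := w0P ((i + Bd) * L + m * N + i).+1.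
  have iM : (i < M)%N by apply: leq_trans Mm; rewrite ltnS leq_addl.
  have := (wP M).2 i x m iM si => xw.
  apply: (@agree_trans _ _ _ _ _ (shiftz (Bd * L)%N%:Z (w M))).
    apply/agree_shiftzr; rewrite shiftzD.
    have -> : - (Bd * L)%N%:Z - blk i * L%:Z = - (i * b * N)%N%:Z.
      by rewrite /blk /L; clear; lia.
    by apply: agree_sub xw; rewrite /blk /L; clear; lia.
  by apply: agree_sub wM; rewrite /blk; clear; lia.
exists w0.
  split=> // k Ik; have uk : (u k)%:Z = blk (u k + Bd)%N by rewrite /blk; clear; lia.
  by have := match_blk _ _ _ (sgW k _ Ik uk); rewrite -uk -!PoszM -!PoszD.
move=> j jBd frj; pose i := absz (j + Bd%:Z).
have ij : blk i = j by rewrite /blk /i; move: jBd; clear; lia.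
have := match_blk i _ _ (sgF i _); rewrite ij => /(_ frj) gw.
have /word_eqP <- := gw.
have [_ <-] := gP j; apply/ffunP => q; rewrite !ffunE /shiftz.
by congr (g _ _); clear; lia.
Qed.

End Specification.

(** * Density of the free blocks *)

Section Windows.
Variables (R : realType) (A : finType).
Local Notation B := (biseq R A).
Implicit Types x y w v : B.
Local Notation f := (@sigma_shift R A).

(** The density is lowest at the end of a window, and there the free run from [v k] to [u k.+1]
    alone already accounts for kappa [v k.+1]. *)
Lemma free_density (u v : nat -> nat) (kappa : R) :
  0 <= kappa <= 1 -> kappa * (v 0)%:R <= (u 0)%:R ->
  (forall k, kappa * (v k.+1)%:R + (v k)%:R <= (u k.+1)%:R) ->
  (forall k, (u k < v k)%N) ->
  forall M, kappa * M%:R <=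
    (count (fun j : nat => `[< free_block [set: nat] u v j%:Z >]) (iota 0 M))%:R.
Proof.
move=> /andP[k0 k1] uv0 uvS uv; set fr := fun j : nat => _.
have vu k : (v k <= u k.+1)%N.
  rewrite -(ler_nat R); apply: le_trans (uvS k); rewrite lerDr mulr_ge0 //.
have uu k : (u k <= u k.+1)%N by apply: leq_trans (vu k); exact: ltnW.
have u_homo : {homo u : i j / (i <= j)%N} by apply: homo_leq => //; exact: leq_trans.
have vuS k k' : (k < k')%N -> (v k <= u k')%N.
  by move=> kk; apply: leq_trans (vu k) _; exact: u_homo.
have v_ge k : (k <= v k)%N.
  elim: k => // k IH; apply: leq_ltn_trans IH _; apply: leq_ltn_trans (vu k) _; exact: uv.
pose D M := count fr (iota 0 M).
have DD a d : (a <= d)%N -> (forall j, (a <= j < d)%N -> fr j) -> (D d = D a + (d - a))%N.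
  move=> ad afr; rewrite /D -{1}(subnKC ad) iotaD count_cat add0n; congr addn.
  rewrite -[RHS](size_iota a) -count_predT; apply: eq_in_count => j.
  by rewrite mem_iota => jad; rewrite afr //; lia.
have Dle a d : (a <= d)%N -> (D a <= D d)%N.
  by move=> ad; rewrite /D -(subnKC ad) iotaD count_cat leq_addr.
(* On the free run [a, c) the count grows with slope 1 >= kappa; on [c, d) it is at least c - a >=
   kappa d. *)
have step (a c d : nat) : (a <= c)%N -> (forall j, (a <= j < c)%N -> fr j) ->
    kappa * a%:R <= (D a)%:R -> kappa * d%:R + a%:R <= c%:R ->
    forall M, (a <= M <= d)%N -> kappa * M%:R <= (D M)%:R.
  move=> ac afr Da dac M /andP[aM Md].
  have [Mc|cM] := leqP M c.
    rewrite (DD a M) //; last by move=> j /andP[aj jM]; apply: afr; rewrite aj (leq_trans jM).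
    rewrite natrD natrB //.
    have : (a%:R : R) <= M%:R by rewrite ler_nat.
    nra.
  apply: le_trans (_ : (D c)%:R <= _); last by rewrite ler_nat Dle // ltnW.
  have : (M%:R : R) <= d%:R by rewrite ler_nat.
  rewrite (DD a c) // natrD natrB //.
  have : (0 : R) <= (D a)%:R by [].
  nra.
have H k : forall M, (M <= v k)%N -> kappa * M%:R <= (D M)%:R.
  elim: k => [|k IH] M Mv.
    apply: (step 0%N (u 0%N) (v 0%N)) => //; rewrite ?mulr0 ?addr0 //.
    move=> j ju; apply/asboolP => k _; have := u_homo _ _ (leq0n k).
    by move: ju; clear; lia.
  have [Mk|kM] := leqP M (v k); first exact: IH.
  apply: (step (v k) (u k.+1) (v k.+1)) => //; last by rewrite ltnW.
  - move=> j /andP[vj ju]; apply/asboolP => k' _.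
    have [kk'|kk'] := leqP k' k.
      have : (v k' <= v k)%N.
        move: kk'; rewrite leq_eqVlt => /orP[/eqP->//|/vuS vk].
        exact: leq_trans vk (ltnW (uv k)).
      by move: vj; clear; lia.
    by have := u_homo _ _ kk'; move: ju; clear; lia.
  - exact: IH.
by move=> M; apply: (H M) => //; exact: v_ge.
Qed.

Lemma sublinear_bound (p : nat -> nat) (e : R) : 0 < e ->
  limn_esup (fun n => ((p n)%:R / n%:R : R)%:E) = 0%E ->
  exists C : nat, forall n, (p n)%:R <= e * n%:R + C%:R.
Proof.
move=> e0 p0; have : (limn_esup (fun n => ((p n)%:R / n%:R : R)%:E) < e%:E)%E by rewrite p0 lte_fin.
move=> /ereal_inf_lt[_ [V [n0 _ n0V] <-] Ve].
exists (\sum_(i < n0.+1) p i)%N => n.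
have [nn|nn] := leqP n n0.
  apply: le_trans (_ : (\sum_(i < n0.+1) p i)%:R <= _); last by rewrite lerDr mulr_ge0 // ltW.
  by rewrite ler_nat (bigD1 (Ordinal (nn : (n < n0.+1)%N))) //= leq_addr.
apply: le_trans (_ : e * n%:R <= _); last by rewrite lerDl.
have n0' : (0 : R) < n%:R by rewrite ltr0n (leq_ltn_trans _ nn).
rewrite -ler_pdivrMr // -lee_fin; apply: le_trans (ltW Ve).
by apply: ereal_sup_ubound; exists n => //; apply: n0V; exact: ltnW.
Qed.

End Windows.

(** * Windows that hit a target *)

Section Targets.
Variables (R : realType) (A : finType).
Local Notation B := (biseq R A).
Implicit Types x y w v : B.
Local Notation f := (@sigma_shift R A).

(* If T is I2 modulo N then T + c is I1 modulo N, so the point y0 of Y with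
   f^I1 y0 = zT has to be copied at the time T + c - I1, which is a multiple of N. *)
Lemma target_window (Y : set B) (N n : nat) (p : nat -> nat) (c : int) (kappa tau : R)
    (vprev : nat) :
  (0 < N)%N -> (0 < n)%N -> iter N f @` Y = Y -> (absz c <= N)%N ->
  limn_esup (fun n => ((p n)%:R / n%:R : R)%:E) = 0%E ->
  0 <= kappa -> 0 <= tau < 1 -> kappa * (1 + tau) < 1 - tau ->
  exists T0 : nat, forall T (zT : B) (I1 I2 : nat), (T0 <= T)%N ->
    (I1 < N)%N -> (I2 < N)%N -> (iter I1 f @` Y) zT ->
    (N%:Z %| T%:Z - I2%:Z)%Z -> I1%:Z - I2%:Z = c ->
  exists (u v l : nat) (y : B), [/\ Y y, (0 < l)%N,
    (u * (n + p n) + l + p l <= v * (n + p n))%N,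
    kappa * v%:R + vprev%:R <= u%:R &
    forall w, agree (u * ((n + p n) * N))%N%:Z (u * ((n + p n) * N) + l * N)%N%:Z
      (shiftz (- (u * ((n + p n) * N))%N%:Z) y) w ->
      mdist (iter T f (shiftz c w)) zT < expR (- (tau * T%:R))].
Proof.
move=> N0 n0 YN cN p0 k0 /andP[t0 t1] kt.
pose b := (n + p n)%N; pose L := (b * N)%N.
have b0 : (0 < b)%N by rewrite addn_gt0 n0.
have L0 : (0 < L)%N by rewrite muln_gt0 b0.
(* The slack: (1 - kappa)(1 - tau) - 2 kappa tau = g. Half of g T pays for the gap [p l], through
   eta = g/4, and the other half for the constants collected in [K]. *)
pose g := 1 - tau - kappa * (1 + tau).
have g0 : 0 < g by rewrite subr_gt0.
have [C pC] := sublinear_bound (divr_gt0 g0 (ltr0n R 4 : 0 < 4%:R)) p0.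
set eta := g / 4%:R in pC.
(* Rounding errors: lN <= 2 tau T + c1 and uL >= (1 - tau)T - c2. *)
pose c1 : R := 3 + L%:R + N%:R.
pose c2 : R := N%:R + 1 + L%:R.
pose K : R := (1 + eta) * c1 + C%:R * N%:R + L%:R + c2 + vprev%:R * L%:R.
have e0 : 0 < eta by rewrite divr_gt0.
have K0 : 0 <= K.
  by rewrite /K !addr_ge0 ?mulr_ge0 ?addr_ge0 //; apply: ltW.
exists (Num.truncn (2 * K / g) + Num.truncn ((N%:R + 2) / (1 - tau)) + N).+1.
move=> T zT I1 I2 TT I1N I2N [y0 Yy0 y0z] /dvdzP[Q QE] I12.
have TK : 2 * K <= g * T%:R.
  have : 2 * K / g <= T%:R.
    apply: ltW; apply: lt_le_trans (truncnS_gt _) _; rewrite ler_nat.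
    by apply: leq_trans TT; rewrite ltnS -addnA leq_addr.
  by rewrite ler_pdivrMr // (mulrC g).
have TN : N%:R + 2 <= (1 - tau) * T%:R.
  have : (N%:R + 2) / (1 - tau) <= T%:R.
    apply: ltW; apply: lt_le_trans (truncnS_gt _) _; rewrite ler_nat.
    by apply: leq_trans TT; rewrite ltnS -addnA addnCA leq_addr.
  by rewrite ler_pdivrMr ?subr_gt0 // (mulrC (1 - tau)).
pose m := (Num.truncn (tau * T%:R)).+1.
have /andP[m1 m2] : tau * T%:R <= m%:R <= tau * T%:R + 1.
  have /andP[] := @truncn_itv _ (tau * T%:R) (mulr_ge0 t0 (ler0n _ _)).
  by rewrite /m -natr1 => h1 h2; rewrite ltW //= lerD2r.
have base0 : (m + N <= T)%N by rewrite -(ler_nat R) natrD; lra.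
(* The leftmost coordinate to be forced, in the coordinates of [w]. The copy starts at the block
   containing it, so [l] must cover the 2m + 1 forced coordinates and up to L more. *)
pose base := absz (T%:Z + c - m%:Z)%R.
have baseE : base%:Z = T%:Z + c - m%:Z by move: base0 cN; rewrite /base; clear; lia.
pose u := (base %/ L)%N.
have u1 : (u * L <= base)%N by exact: leq_trunc_div.
have u2 : (base < u.+1 * L)%N by exact: ltn_ceil.
pose l := ((m + m + 1 + L) %/ N).+1.
have l1 : (m + m + 1 + L < l * N)%N by exact: ltn_ceil.
have l2 : (l * N <= m + m + 1 + L + N)%N.
  by rewrite /l mulSnr leq_add2r leq_trunc_div.
pose v := ((u * b + l + p l) %/ b).+1.
have v1 : (u * b + l + p l < v * b)%N by exact: ltn_ceil.
have v2 : (v * b <= u * b + l + p l + b)%N.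
  by rewrite /v mulSnr leq_add2r leq_trunc_div.
(* Undoing the shift by uL leaves [y0] placed at coordinate QN = T - I2 = T + c - I1. *)
exists u, v, l, (shiftz ((u * L)%N%:Z - Q * N%:Z) y0); split => //.
- rewrite (_ : _ - _ = N%:Z * ((u * b)%N%:Z - Q)); first exact: shiftz_stable.
  by rewrite /L; clear; lia.
- exact: ltnW.
- have Lr : (0 : R) < L%:R by rewrite ltr0n.
  rewrite -(ler_pM2r Lr) mulrDl -mulrA.
  have ua : T%:R - N%:R - m%:R - L%:R <= u%:R * L%:R :> R.
    rewrite !lerBlDr -natrM -!natrD ler_nat.
    by move: u2 baseE cN; rewrite mulSn; clear; lia.
  have vL : v%:R * L%:R <= u%:R * L%:R + l%:R * N%:R + (p l)%:R * N%:R + L%:R :> R.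
    rewrite -!natrM -!natrD ler_nat.
    rewrite /L !mulnA -!mulnDl leq_mul2r; apply/orP; right.
    exact: v2.
  have pl : (p l)%:R * N%:R <= eta * (l%:R * N%:R) + C%:R * N%:R :> R.
    by rewrite mulrA -mulrDl ler_wpM2r.
  have lN : l%:R * N%:R <= 2 * (tau * T%:R) + c1 :> R.
    have : (l * N)%N%:R <= (m + m + 1 + L + N)%N%:R :> R by rewrite ler_nat.
    by rewrite natrM !natrD /c1; lra.
  have k1 : kappa <= 1 by nra.
  have T0 : 0 <= T%:R :> R by [].
  have main : v%:R * L%:R <= u%:R * L%:R + (1 + eta) * (2 * (tau * T%:R) + c1) + C%:R * N%:R + L%:R.
    apply: (le_trans vL); have : (1 + eta) * (l%:R * N%:R) <= (1 + eta) * (2 * (tau * T%:R) + c1).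
      by rewrite ler_wpM2l // addr_ge0 // ltW.
    by move: pl; clear; lra.
  set a := u%:R * L%:R in ua main *.
  have ha : (1 - tau) * T%:R - c2 <= a by rewrite /c2; move: ua m2; clear; lra.
  have hk := ler_wpM2l k0 main.
  pose X1 := (1 + eta) * c1 + C%:R * N%:R + L%:R.
  have X1E : K = X1 + c2 + vprev%:R * L%:R by rewrite /K /X1; ring.
  have X10 : 0 <= X1 by rewrite /X1 !addr_ge0 ?mulr_ge0 ?addr_ge0 // ltW.
  have c20 : 0 <= c2 by rewrite /c2 !addr_ge0.
  have h1 : (1 - kappa) * ((1 - tau) * T%:R - c2) <= (1 - kappa) * a.
    by rewrite ler_wpM2l // subr_ge0.
  have kt1 : kappa * tau <= 1 by clear - k0 k1 t0 t1; nra.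
  have h2 : kappa * tau * (eta * T%:R) <= eta * T%:R.
    by rewrite -[leRHS]mul1r ler_wpM2r // mulr_ge0 // ltW.
  have h3 : kappa * X1 <= X1 by rewrite -[leRHS]mul1r ler_wpM2r.
  have h4 : 0 <= kappa * c2 by rewrite mulr_ge0.
  have h5 : 4 * (eta * T%:R) = (1 - tau - kappa * (1 + tau)) * T%:R.
    by rewrite /eta /g; field.
  have h6 : 2 * K <= 4 * (eta * T%:R) by rewrite h5.
  apply: (le_trans (lerD hk (lexx _))).
  have -> : kappa * (a + (1 + eta) * (2 * (tau * T%:R) + c1) + C%:R * N%:R + L%:R) =
     kappa * a + 2 * (kappa * tau * T%:R) + 2 * (kappa * tau * (eta * T%:R)) + kappa * X1.
    by rewrite /X1; ring.
  rewrite X1E in h6; clear - h1 h2 h3 h4 h5 h6; lra.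
move=> w yw; apply: (@lt_le_trans _ _ (expR (- m%:R))); last by rewrite ler_expR lerN2.
apply: agree_mdist_lt; rewrite -y0z !iter_shift shiftzD => k km kM.
rewrite /shiftz.
have := yw (k + (T%:Z + c)); rewrite /shiftz -/b -/L => <-.
- congr y0; move: QE I12; clear; lia.
- by move: baseE u1 km; clear; lia.
- by move: baseE u2 kM l1; rewrite mulSn; clear; lia.
Qed.

End Targets.

(** * Counting words *)

Section Counting.
Variables (R : realType) (A : finType).
Local Notation B := (biseq R A).
Implicit Types x y w v : B.
Local Notation f := (@sigma_shift R A).

Lemma card_lang_cat (Y : set B) (a l : nat) : (forall w, Y w -> Y (shiftz a%:Z w)) ->
  (#|lang Y (a + l)| <= #|lang Y a| * #|lang Y l|)%N.
Proof.
move=> Ya; rewrite -cardsX.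
pose F (u : {ffun 'I_(a + l) -> A}) : {ffun 'I_a -> A} * {ffun 'I_l -> A} :=
  ([ffun i => u (lshift l i)], [ffun i => u (rshift a i)]).
have Finj : injective F.
  move=> u u' [/ffunP u1 /ffunP u2]; apply/ffunP => i.
  rewrite -(splitK i); case: (fintype.split i) => j /=.
    by have := u1 j; rewrite !ffunE.
  by have := u2 j; rewrite !ffunE.
rewrite -(card_imset _ Finj); apply/subset_leq_card/fintype.subsetP => p /imsetP[u].
move=> /langP[x Yx <-] ->; rewrite finset.in_setX /=; apply/andP; split; apply/langP.
  by exists x => //; apply/ffunP => i; rewrite !ffunE.
exists (shiftz a%:Z x); first exact: Ya.
by apply/ffunP => i; rewrite !ffunE /shiftz /=; congr x; clear; lia.
Qed.

Lemma card_lang_mul (Y : set B) (N l q : nat) : iter N f @` Y = Y -> (N %| l)%N ->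
  (#|lang Y (q * l)| <= #|lang Y l| ^ q)%N.
Proof.
move=> YN /dvdnP[m ->]; elim: q => [|q IH].
  rewrite expn0; apply: leq_trans (max_card _) _.
  by rewrite card_ffun card_ord expn0.
rewrite expnS mulSn; apply: leq_trans (card_lang_cat _ _) _.
  move=> w Yw; have -> : (m * N)%N%:Z = N%:Z * m%:Z by clear; lia.
  exact: shiftz_stable.
by rewrite leq_mul2l IH orbT.
Qed.

(** A word of [X] is read inside a longer word of [Y] at one of N offsets. *)
Lemma card_lang_bigcup (X Y : set B) (N M K : nat) :
  X = \bigcup_(l in `I_N) (iter l f @` Y) -> (M + N <= K)%N ->
  (#|lang X M| <= N * #|lang Y K|)%N.
Proof.
move=> XE MNK; have H (i : 'I_N) (j : 'I_M) : (i + j < K)%N.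
  by apply: leq_trans MNK; rewrite addnC -addnS leq_add // ltnW.
pose g (p : 'I_N * {ffun 'I_K -> A}) : {ffun 'I_M -> A} :=
  [ffun j => p.2 (Ordinal (H p.1 j))].
rewrite -[X in (_ <= X * _)%N](card_ord N) -finset.cardsT -cardsX.
apply: leq_trans (leq_imset_card g _); apply/subset_leq_card/fintype.subsetP => u.
move=> /langP[x]; rewrite XE => -[i /= iN [y Yy <-]] <-.
apply/imsetP; exists (Ordinal iN, word 0 K y).
  by rewrite finset.in_setX inE /=; apply/langP; exists y.
apply/ffunP => j; rewrite !ffunE /= iter_shift /shiftz; congr y; clear; lia.
Qed.

Lemma card_lang_gt0 (Y : set B) (l : nat) : Y !=set0 -> (0 < #|lang Y l|)%N.
Proof.
by move=> [y Yy]; rewrite card_gt0; apply/set0Pn; exists (word 0 l y); apply/langP; exists y.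
Qed.

End Counting.

(** * Lower bounds for shrinking targets *)

Section Lower.
Variables (R : realType) (A : finType).
Local Notation B := (biseq R A).
Implicit Types x y w : B.
Local Notation f := (@sigma_shift R A).

(* 2^i + j with j < 2^i is sent to j, so every j is a value at arbitrarily large arguments. *)
Definition recurrent_index (k : nat) : nat := maxn 1 (k - 2 ^ trunc_log 2 k).

Lemma recurrent_indexP j M : (1 <= j)%N -> exists2 k, (M <= k)%N & recurrent_index k = j.
Proof.
move=> j1; pose i := (M + j)%N; have i1 : (i < 2 ^ i)%N by exact: ltn_expl.
exists (2 ^ i + j)%N; first by move: i1; rewrite /i; lia.
rewrite /recurrent_index (_ : trunc_log 2 _ = i); first by rewrite addKn; lia.
apply: trunc_log_eq => //; rewrite leq_addr expnS mul2n -addnn ltn_add2l /=.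
by apply: leq_ltn_trans i1; rewrite /i leq_addl.
Qed.

Lemma infinite_setP (S : set nat) :
  infinite_set S <-> forall M, exists2 n, (M <= n)%N & S n.
Proof.
split=> [iS M|H].
  apply: contrapT => nM; apply: iS; apply: (sub_finite_set _ (finite_II M)) => n Sn /=.
  by rewrite ltnNge; apply/negP => Mn; apply: nM; exists n.
move=> /finite_seqP[r Sr]; have [n] := H (\max_(i <- r) i).+1.
rewrite Sr /= ltnNge => /negP nr nS; apply: nr.
exact: (@leq_bigmax_seq _ r xpredT id).
Qed.

Variables (X Y : set B) (N : nat) (p : nat -> nat).
Hypotheses (Yne : Y !=set0) (cY : compact Y) (N0 : (0 < N)%N).
Hypothesis YN : iter N f @` Y = Y.
Hypothesis specY : gluing Y N p.
Hypothesis p0 : limn_esup (fun n => ((p n)%:R / n%:R : R)%:E) = 0%E.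
Hypotheses (Xs : forall c w, X w -> X (shiftz c w)) (YX : Y `<=` X).

(** The window construction with no window at all: every block is free, so the density is 1. *)
Lemma htop_ge_specification n : (0 < n)%N ->
  ((ln (#|lang Y (n * N)|%:R : R) / ((n + p n) * N)%N%:R)%:E <= htop X f X)%E.
Proof.
move=> n0; have W0 := card_lang_gt0 (n * N) Yne.
have L0 : (0 < (n + p n) * N)%N by rewrite muln_gt0 addn_gt0 n0.
have nl : (n * N <= (n + p n) * N)%N by rewrite leq_mul2r leq_addr orbT.
have [y0 _] := Yne.
have rK := @rich_window_set R A Y N p Yne cY N0 YN specY set0 (fun=> 0%N) (fun=> 0%N)
  (fun=> 0%N) (fun=> y0) n n0 (fun _ => False_ind _) (fun _ => False_ind _)
  (fun _ => False_ind _) (fun _ _ => False_ind _).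
have cK := @compact_window_set R A Y N p cY set0 (fun=> 0%N) (fun=> 0%N) (fun=> y0) n.
have Wr : (0 : R) < #|lang Y (n * N)|%:R by rewrite ltr0n.
have Lr : (0 : R) < ((n + p n) * N)%N%:R by rewrite ltr0n.
apply: (@htop_ge _ _ _ _ _ _ ((#|lang Y (n * N)|%:R : R)^-1 ^+ 3)).
  by rewrite exprn_gt0 // invr_gt0.
move=> t e m /andP[t0 tW] /andP[e0 e1].
apply: (bowen_sum_lower (c := 0) (kappa := 1) cK rK W0 nl L0) => //.
- by rewrite lexx ler01.
- move=> M; rewrite mul1r ler_nat (@eq_count _ _ predT) ?count_predT ?size_iota //.
  by move=> j; apply/asboolP.
- by move=> w [Yw _]; rewrite shiftz0; exact: YX.
- by rewrite mul1r -ler_pdivlMr.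
Qed.

Variables (phi : nat -> nat -> R) (z : nat -> nat -> B) (s : nat -> nat -> nat).
Variables (c : int) (kappa tau : R).
(** All that the construction needs from radii, centres and times. The same [c] serves every [j],
    since the constructed point is moved only once. *)
Hypothesis good : forall j M, (1 <= j)%N -> exists T, [/\ (M <= T)%N, range (s j) T,
  expR (- (tau * T%:R)) <= phi j T & exists I1 I2, [/\ (I1 < N)%N, (I2 < N)%N,
    (iter I1 f @` Y) (z j T), (N%:Z %| T%:Z - I2%:Z)%Z & I1%:Z - I2%:Z = c]].
Hypotheses (k0 : 0 <= kappa) (t01 : 0 <= tau < 1) (kt : kappa * (1 + tau) < 1 - tau).
Let S := \bigcap_(j in [set j : nat | (1 <= j)%N])
  shrinking_target X f (phi j) (z j) (range (s j)).

Let cN : (absz c <= N)%N.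
Proof.
have [T [_ _ _ [I1 [I2 [I1N I2N _ _ <-]]]]] := good 0 (leqnn 1).
by move: I1N I2N; clear; lia.
Qed.

(** Windows are chosen recursively, each so far beyond the previous one that the density condition
    holds; [recurrent_index] serves every [j] infinitely often. *)
Lemma window_sequence n : (0 < n)%N -> exists (u v l : nat -> nat) (y : nat -> B),
  [/\ forall k, Y (y k), forall k, (0 < l k)%N,
      forall k, (u k * (n + p n) + l k + p (l k) <= v k * (n + p n))%N &
      [/\ kappa * (v 0)%:R <= (u 0)%:R,
          forall k, kappa * (v k.+1)%:R + (v k)%:R <= (u k.+1)%:R &
          forall w, window_set Y N p [set: nat] u l y n w -> S (shiftz c w)]].
Proof.
move=> n0; set b := (n + p n)%N; set L := (b * N)%N.
have /choice[st stP] : forall jv : nat * nat, exists t : nat * (nat * nat * nat * B),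
    (1 <= jv.1)%N -> [/\ (jv.2 <= t.1)%N, range (s jv.1) t.1,
    [/\ Y t.2.2, (0 < t.2.1.2)%N,
      (t.2.1.1.1 * b + t.2.1.2 + p t.2.1.2 <= t.2.1.1.2 * b)%N &
      kappa * t.2.1.1.2%:R + jv.2%:R <= t.2.1.1.1%:R] &
    forall w, agree (t.2.1.1.1 * L)%N%:Z (t.2.1.1.1 * L + t.2.1.2 * N)%N%:Z
      (shiftz (- (t.2.1.1.1 * L)%N%:Z) t.2.2) w ->
      mdist (iter t.1 f (shiftz c w)) (z jv.1 t.1) < phi jv.1 t.1].
  move=> [j vp] /=; have [y0 _] := Yne.
  have [j1|j0] := leqP 1 j; last by exists (0%N, (0%N, 0%N, 0%N, y0)).
  have [T0 T0P] := @target_window R A Y N n p c kappa tau vp N0 n0 YN cN p0 k0 t01 kt.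
  (* T >= vp forces the target times to infinity, so that each [j] is hit at infinitely many
     different times. *)
  have [T [TM Ts Tphi [I1 [I2 [I1N I2N zT NT I12]]]]] := good (maxn T0 vp) j1.
  have T0T : (T0 <= T)%N by apply: leq_trans TM; exact: leq_maxl.
  have [u [v [l [y [Yy l0 lb kuv H]]]]] := T0P T (z j T) I1 I2 T0T I1N I2N zT NT I12.
  exists (T, (u, v, l, y)) => _ /=; split => //.
    by apply: leq_trans TM; exact: leq_maxr.
  by move=> w /H /lt_le_trans; exact.
pose sq := fix sq k := match k with
  | 0 => st (recurrent_index 0, 0%N)
  | k'.+1 => st (recurrent_index k, (sq k').2.1.1.2) end.
pose pv k := match k with 0 => 0%N | k'.+1 => (sq k').2.1.1.2 end.
have sqE k : sq k = st (recurrent_index k, pv k) by case: k.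
have r1 k : (1 <= recurrent_index k)%N by exact: leq_maxl.
have sqP k := stP (recurrent_index k, pv k) (r1 k).
have b0 : (0 < b)%N by rewrite addn_gt0 n0.
exists (fun k => (sq k).2.1.1.1), (fun k => (sq k).2.1.1.2), (fun k => (sq k).2.1.2),
  (fun k => (sq k).2.2).
have conds k : [/\ Y (sq k).2.2, (0 < (sq k).2.1.2)%N,
      ((sq k).2.1.1.1 * b + (sq k).2.1.2 + p (sq k).2.1.2 <= (sq k).2.1.1.2 * b)%N &
      kappa * (sq k).2.1.1.2%:R + (pv k)%:R <= (sq k).2.1.1.1%:R].
  by rewrite sqE; have [_ _ h _] := sqP k.
have pv_ge k : (k <= pv k)%N.
  elim: k => // k IH; apply: (leq_ltn_trans IH).
  have [_ l0 lb kuv] := conds k.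
  have : (pv k <= (sq k).2.1.1.1)%N.
    by rewrite -(ler_nat R); apply: le_trans kuv; rewrite lerDr mulr_ge0.
  move=> /leq_ltn_trans; apply; rewrite /= -(ltn_pmul2r b0).
  by apply: leq_trans lb; rewrite -addnA -addn1 leq_add2l addn_gt0 l0.
split.
- by move=> k; have [] := conds k.
- by move=> k; have [] := conds k.
- by move=> k; have [] := conds k.
split.
- by have [_ _ _ /=] := conds 0%N; rewrite addr0.
- by move=> k; have [_ _ _ /=] := conds k.+1.
move=> w [Yw wP] j j1; split; first exact/Xs/YX.
apply/infinite_setP => M; have [k Mk kj] := recurrent_indexP M j1.
have [pT rT _ H] := sqP k; rewrite -sqE /= kj in pT rT H; exists (sq k).1.
  by apply: leq_trans pT; apply: leq_trans (pv_ge k).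
split=> //; apply: H; have := wP k I; by rewrite sqE.
Qed.

Lemma shrinking_target_lower n : (0 < n)%N -> S !=set0 /\ forall t, 0 <= t ->
  (t * ((n + p n) * N)%N%:R <= kappa * ln (#|lang Y (n * N)|%:R : R) ->
     (t%:E <= htop X f S)%E) /\
  (t * ((n + p n) * N)%N%:R <= (1 + kappa) * ln (#|lang Y (n * N)|%:R : R) ->
     (t%:E <= hausdorff_dim S)%E).
Proof.
move=> n0; have [u [v [l [y [Yy l0 lb [uv0 uvS wS]]]]]] := window_sequence n0.
have W0 := card_lang_gt0 (n * N) Yne.
have b0 : (0 < n + p n)%N by rewrite addn_gt0 n0.
have L0 : (0 < (n + p n) * N)%N by rewrite muln_gt0 b0.
have nl : (n * N <= (n + p n) * N)%N by rewrite leq_mul2r leq_addr orbT.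
have Wr : (0 : R) < #|lang Y (n * N)|%:R by rewrite ltr0n.
have Lr : (0 : R) < ((n + p n) * N)%N%:R by rewrite ltr0n.
have k01 : 0 <= kappa <= 1.
  move: (k0) (t01) (kt) => k0' /andP[t0 t1] kt'; rewrite k0' /=; nra.
have cL : (absz c <= (n + p n) * N)%N by apply: leq_trans cN _; rewrite leq_pmull.
have uvk k : (u k < v k)%N.
  rewrite -(ltn_pmul2r b0); apply: leq_trans (lb k).
  by rewrite -addnA -addn1 leq_add2l addn_gt0 l0.
have vu k : (v k <= u k.+1)%N.
  by rewrite -(ler_nat R); apply: le_trans (uvS k); rewrite lerDr mulr_ge0.
have u_homo : {homo u : i j / (i <= j)%N}.
  apply: homo_leq => // [i j k|k]; first exact: leq_trans.
  by apply: leq_trans (vu k); exact: ltnW.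
have vuS k k' : (k < k')%N -> (v k <= u k')%N.
  by move=> kk; apply: leq_trans (vu k) _; exact: u_homo.
have rK := @rich_window_set R A Y N p Yne cY N0 YN specY [set: nat] u v l y n n0
  (fun k _ => Yy k) (fun k _ => l0 k) (fun k _ => lb k) (fun k k' _ _ => @vuS k k').
have cK := @compact_window_set R A Y N p cY [set: nat] u l y n.
have dens := free_density k01 uv0 uvS uvk.
split.
  have /set0Pn[u0 u0V] : lang Y (n * N) != finset.set0 by rewrite -card_gt0.
  by have [w Kw _] := rK 0%N (fun=> u0) (fun=> u0V); exists (shiftz c w); exact: wS.
move=> t t0; split=> tW.
  apply: (@htop_ge _ _ _ _ _ _ ((#|lang Y (n * N)|%:R : R)^-1 ^+ 3)).
    by rewrite exprn_gt0 // invr_gt0.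
  move=> t' e m /andP[t'0 t't] /andP[e0 e1].
  apply: (bowen_sum_lower cK rK W0 nl L0 cL k01 dens wS) => //.
  by apply: le_trans tW; rewrite ler_wpM2r.
apply: hausdorff_dim_ge => t' /andP[t'0 t't].
apply: (hausdorff_premeasure_lower cK rK W0 nl L0 cL k01 dens wS) => //.
  move=> j j0 k _; move: j0; clear; lia.
by apply: le_trans tW; rewrite ler_wpM2r.
Qed.

End Lower.

(** * Growth of the number of words *)

Section Entropy.
Variables (R : realType) (A : finType).
Local Notation B := (biseq R A).
Implicit Types x y w : B.
Local Notation f := (@sigma_shift R A).

Variables (X Y : set B) (N : nat) (p : nat -> nat).
Hypotheses (Yne : Y !=set0) (cY : compact Y) (N0 : (0 < N)%N).
Hypothesis YN : iter N f @` Y = Y.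
Hypothesis specY : gluing Y N p.
Hypothesis p0 : limn_esup (fun n => ((p n)%:R / n%:R : R)%:E) = 0%E.
Hypotheses (Xs : forall c w, X w -> X (shiftz c w)) (YX : Y `<=` X).
Hypothesis XE : X = \bigcup_(l in `I_N) (iter l f @` Y).

(** The upper bound for limsup sets at t = 0, with submultiplicativity as word count. *)
Lemma htop_le_words n : (0 < n)%N ->
  (htop X f X <= (ln (#|lang Y (n * N)|%:R : R) / (n * N)%N%:R)%:E)%E.
Proof.
move=> n0; have [y0 _] := Yne.
have W0 := card_lang_gt0 (n * N) Yne.
set W := #|lang Y (n * N)| in W0 *; set l := (n * N)%N.
have l0 : (0 < l)%N by rewrite muln_gt0 n0.
have lr : (0 : R) < l%:R by rewrite ltr0n.
have lnW : 0 <= ln (W%:R : R) by rewrite ln_ge0 // ler1n.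
have h0 : 0 <= ln (W%:R : R) / l%:R by rewrite divr_ge0.
have C0 : (0 : R) <= N%:R * expR (2 * ln W%:R) by rewrite mulr_ge0 // expR_ge0.
have XC M : (#|lang X M|%:R : R) <= N%:R * expR (2 * ln W%:R) * expR (ln W%:R / l%:R * M%:R).
  (* One extra block for rounding, one for the offset up to N <= l; together they give the factor
     e^(2 ln W). *)
  pose q := (M %/ l).+2.
  have Mq : (M + N <= q * l)%N.
    rewrite /q mulSn addnC leq_add //; first by rewrite /l leq_pmull.
    exact/ltnW/ltn_ceil.
  have Nl : (N %| l)%N by rewrite /l dvdn_mull.
  apply: le_trans (_ : (N * W ^ q)%N%:R <= _).
    rewrite ler_nat; apply: leq_trans (card_lang_bigcup XE Mq) _.
    by rewrite leq_mul2l (card_lang_mul q YN Nl) orbT.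
  rewrite natrM -mulrA; apply: ler_wpM2l => //.
  rewrite natrX -[X in X ^+ q](@lnK _ W%:R) ?posrE ?ltr0n // -expRM_natl -expRD ler_expR.
  rewrite (_ : 2 * _ + _ = (2 + M%:R / l%:R) * ln W%:R); last by ring.
  rewrite ler_wpM2r //.
  rewrite /q -addn2 natrD addrC lerD2l ler_pdivlMr // -natrM ler_nat.
  exact: leq_trunc_div.
(* At t = 0 the window is empty, so any centre works. *)
have Zz x (n1 : nat) : X x -> exists2 m, (n1 <= m)%N &
    agree (- (Num.truncn (0 * m%:R : R))%:Z) (Num.truncn (0 * m%:R : R))%:Z (shiftz m%:Z x) y0.
  by move=> _; exists n1 => // k; rewrite mul0r truncn0; clear; lia.
have := @htop_upper R A y0 X X _ _ 0 (fun=> y0) Xs C0 h0 (lexx 0) XC (@subset_refl _ X) Zz ltr01.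
by rewrite subr0 addr0 divr1 mul1r.
Qed.

Lemma htop_fin_num : htop X f X \is a fin_num.
Proof.
rewrite ge0_fin_numE ?htop_ge0 //.
by apply: le_lt_trans (htop_le_words (ltn0Sn 0)) _; rewrite ltry.
Qed.

(** Specification gives ln W <= h(n + p n)N, and p n <= e n + C makes the gaps a small relative
    error. *)
Lemma lang_growth (h' : R) : (htop X f X < h'%:E)%E ->
  exists2 C : R, 0 <= C & forall M, (#|lang X M|%:R : R) <= C * expR (h' * M%:R).
Proof.
move: htop_fin_num => /fineK; set h := fine _ => hE; rewrite -hE lte_fin => hh.
have h0 : 0 <= h by rewrite -lee_fin hE htop_ge0.
(* Chosen so that h(1 + e) <= h'; the 1 covers h = 0. *)
pose e := (h' - h) / (h + 1).
have h1 : 0 < h + 1 by rewrite ltr_wpDl.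
have e0 : 0 < e by rewrite divr_gt0 // subr_gt0.
have [C pC] := sublinear_bound e0 p0.
exists (N%:R * expR (h * (1 + e) * (2 * N%:R) + h * C%:R * N%:R)).
  by rewrite mulr_ge0 // expR_ge0.
move=> M; pose n := (M %/ N).+2.
have Mn : (M + N <= n * N)%N by rewrite /n mulSn addnC leq_add2l ltnW // ltn_ceil.
have nM : (n * N <= M + 2 * N)%N.
  by rewrite /n -addn2 mulnDl leq_add2r leq_trunc_div.
have W0 := card_lang_gt0 (n * N) Yne.
have := htop_ge_specification Yne cY N0 YN specY YX (ltn0Sn _ : (0 < n)%N).
rewrite -hE lee_fin; set W := #|lang Y (n * N)| in W0 *.
have L0 : (0 < (n + p n) * N)%N by rewrite muln_gt0.
rewrite ler_pdivrMr ?ltr0n // => Wh.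
apply: le_trans (_ : (N * W)%N%:R <= _).
  by rewrite ler_nat (card_lang_bigcup XE Mn).
rewrite natrM -mulrA; apply: ler_wpM2l => //.
rewrite -[leLHS](@lnK _ W%:R) ?posrE ?ltr0n // -expRD ler_expR; apply: (le_trans Wh).
have pn := pC n; have nM' : (n * N)%N%:R <= (M + 2 * N)%N%:R :> R by rewrite ler_nat.
rewrite natrM natrD; rewrite natrM natrD natrM in nM'.
have N0' : (0 : R) <= N%:R by [].
have s1 : (n%:R + (p n)%:R) * N%:R <= (1 + e) * (M%:R + 2 * N%:R) + C%:R * N%:R.
  apply: le_trans (_ : ((1 + e) * n%:R + C%:R) * N%:R <= _).
    by apply: ler_wpM2r => //; lra.
  by rewrite mulrDl lerD2r -mulrA ler_wpM2l // addr_ge0 // ltW.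
have s2 := ler_wpM2l h0 s1.
have s3 : h * (1 + e) <= h'.
  have : e * (h + 1) = h' - h by rewrite /e divfK // gt_eqF.
  by lra.
have s4 : h * (1 + e) * M%:R <= h' * M%:R by rewrite ler_wpM2r.
lra.
Qed.

End Entropy.

(** * Decay rates of the radii *)

Section Decay.
Variable R : realType.
Implicit Types phi : nat -> R.

Lemma lt_decay_liminf phi (t : R) : (t%:E < decay_liminf phi)%E -> (forall n, 0 < phi n) ->
  exists n0, forall n, (n0 <= n)%N -> phi n <= expR (- (t * n%:R)).
Proof.
rewrite /decay_liminf /limn_einf lteNr => + phi0.
move=> /ereal_inf_lt[_ [V [n0 _ n0V] <-] Vt].
(* The successor keeps n positive, so that the quotient by n can be cleared. *)
exists n0.+1 => n nn; have n0' : (0 : R) < n%:R by rewrite ltr0n (leq_trans _ nn).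
have : (- (- ln (phi n) / n%:R)%:E < - t%:E)%E.
  apply: le_lt_trans Vt; apply: ereal_sup_ubound; exists n => //; apply: n0V.
  exact: ltnW.
rewrite -!EFinN lte_fin ltrN2 ltr_pdivlMr // => tn.
by rewrite -[leLHS]lnK ?posrE // ler_expR lerNr ltW.
Qed.

Lemma decay_limsup_lt phi (t : R) : (decay_limsup phi < t%:E)%E -> (forall n, 0 < phi n) ->
  exists n0, forall n, (n0 <= n)%N -> expR (- (t * n%:R)) <= phi n.
Proof.
move=> + phi0 => /ereal_inf_lt[_ [V [n0 _ n0V] <-] Vt].
exists n0.+1 => n nn; have n0' : (0 : R) < n%:R by rewrite ltr0n (leq_trans _ nn).
have : ((- ln (phi n) / n%:R)%:E < t%:E)%E.
  by apply: le_lt_trans Vt; apply: ereal_sup_ubound; exists n => //; apply: n0V; exact: ltnW.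
rewrite lte_fin ltr_pdivrMr // => tn.
by rewrite -[leRHS]lnK ?posrE // ler_expR lerNl ltW.
Qed.

Lemma decay_liminf_lt phi (t : R) : (decay_liminf phi < t%:E)%E -> (forall n, 0 < phi n) ->
  forall M, exists2 n, (M <= n)%N & expR (- (t * n%:R)) <= phi n.
Proof.
move=> + phi0 M; rewrite ltNge => /negP phit; apply: contrapT => nM; apply: phit.
rewrite /decay_liminf /limn_einf leeNr; apply: ereal_inf_le.
exists (ereal_sup [set (- (- ln (phi n) / n%:R)%:E)%E | n in [set n | (M.+1 <= n)%N]]).
  by exists [set n | (M.+1 <= n)%N] => //; exists M.+1.
apply: ge_ereal_sup => _ [n /= Mn <-]; rewrite lee_fin lerN2.
have n0' : (0 : R) < n%:R by rewrite ltr0n (leq_trans _ Mn).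
rewrite ler_pdivlMr // lerNr -ler_expR lnK ?posrE //.
rewrite leNgt; apply/negP => h; apply: nM; exists n; [exact: ltnW|exact: ltW].
Qed.

Lemma decay_liminf_ge0 phi : (forall n, 0 < phi n <= 1) -> (0 <= decay_liminf phi)%E.
Proof.
move=> phi01; rewrite /decay_liminf /limn_einf oppe_ge0; apply: ereal_inf_le.
exists (ereal_sup [set (- (- ln (phi n) / n%:R)%:E)%E | n in [set: nat]]).
  by exists [set: nat] => //; exact: filterT.
apply: ge_ereal_sup => _ [n _ <-]; rewrite -EFinN lee_fin oppr_le0 divr_ge0 //.
by have /andP[_ p1] := phi01 n; rewrite oppr_ge0 ln_le0.
Qed.

End Decay.

(** * Limits of the bounds *)

Section Asymptotics.
Variables (R : realType) (A : finType).
Local Notation B := (biseq R A).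
Implicit Types x y w : B.
Local Notation f := (@sigma_shift R A).

Variables (X Y : set B) (N : nat) (p : nat -> nat).
Hypotheses (Yne : Y !=set0) (cY : compact Y) (N0 : (0 < N)%N).
Hypothesis YN : iter N f @` Y = Y.
Hypothesis specY : gluing Y N p.
Hypothesis p0 : limn_esup (fun n => ((p n)%:R / n%:R : R)%:E) = 0%E.
Hypotheses (Xs : forall c w, X w -> X (shiftz c w)) (YX : Y `<=` X).
Hypothesis XE : X = \bigcup_(l in `I_N) (iter l f @` Y).

Let h : R := fine (htop X f X).
Let hE : htop X f X = h%:E.
Proof. by rewrite /h fineK // (htop_fin_num Yne N0 YN Xs XE). Qed.
Let h0 : 0 <= h.
Proof. by rewrite -lee_fin -hE htop_ge0. Qed.

Lemma shrinking_target_ge (phi : nat -> nat -> R) (z : nat -> nat -> B)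
    (s : nat -> nat -> nat) (c : int) (tau0 : R)
    (S := \bigcap_(j in [set j : nat | (1 <= j)%N])
      shrinking_target X f (phi j) (z j) (range (s j))) :
  0 <= tau0 < 1 ->
  (forall tau, tau0 < tau < 1 -> forall j M, (1 <= j)%N -> exists T,
    [/\ (M <= T)%N, range (s j) T, expR (- (tau * T%:R)) <= phi j T &
        exists I1 I2, [/\ (I1 < N)%N, (I2 < N)%N, (iter I1 f @` Y) (z j T),
          (N%:Z %| T%:Z - I2%:Z)%Z & I1%:Z - I2%:Z = c]]) ->
  [/\ S !=set0, (((1 - tau0) / (1 + tau0) * h)%:E <= htop X f S)%E &
      ((2 / (1 + tau0) * h)%:E <= hausdorff_dim S)%E].
Proof.
move=> /andP[t0 t1] good.
have tp : 0 < 1 + tau0 by rewrite ltr_wpDr.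
pose a := (1 - tau0) / (1 + tau0).
have aE : a * (1 + tau0) = 1 - tau0 by rewrite /a divfK // gt_eqF.
have a0 : 0 <= a by rewrite divr_ge0 // ?subr_ge0 ltW.
have a1 : a <= 1 by rewrite /a ler_pdivrMr // mul1r lerD2l; lra.
have a2 : 2 / (1 + tau0) = 1 + a by rewrite /a; field; rewrite gt_eqF.
have h1 : 0 < 5 * h + 5 by rewrite ltr_wpDl // mulr_ge0.
have key (e : R) : 0 < e -> S !=set0 /\ ((a * h - e)%:E <= htop X f S)%E /\
    (((1 + a) * h - e)%:E <= hausdorff_dim S)%E.
  (* The 5 is 3 + 2: lowering [kappa] costs 3dh, the factor 1/(1 + d) for the gaps at most 2dh. *)
  move=> e0; pose d := Num.min (e / (5 * h + 5)) ((1 - tau0) / 2).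
  have d0 : 0 < d by rewrite /d lt_min !divr_gt0 // subr_gt0.
  have d1 : d <= (1 - tau0) / 2 by rewrite /d ge_min lexx orbT.
  have d2 : d * (5 * h + 5) <= e by rewrite -ler_pdivlMr // /d ge_min lexx.
  pose tau := tau0 + d; have tau01 : tau0 < tau < 1 by rewrite /tau; lra.
  pose kappa := Num.max 0 (a - 3 * d).
  have k0 : 0 <= kappa by rewrite /kappa le_max lexx.
  have ka : a - 3 * d <= kappa by rewrite /kappa le_max lexx orbT.
  have ad : a * d <= d by rewrite -[leRHS]mul1r ler_wpM2r // ltW.
  have kt : kappa * (1 + tau) < 1 - tau.
    have dt : 0 <= d * tau0 by rewrite mulr_ge0 // ltW.
    have dd : 0 < d * d by rewrite mulr_gt0.
    rewrite /kappa; case: (leP 0 (a - 3 * d)) => _; last by rewrite mul0r; lra.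
    rewrite /tau; have -> : (a - 3 * d) * (1 + (tau0 + d)) =
      a * (1 + tau0) + a * d - 3 * d - 3 * (d * tau0) - 3 * (d * d) by ring.
    by rewrite aE; lra.
  have k1 : kappa <= 1 by rewrite /kappa ge_max ler01 /=; lra.
  have d20 : 0 < d / 2 by rewrite divr_gt0.
  have [C pC] := sublinear_bound d20 p0.
  (* Half of d n bounds the linear part of [p n], the other half its constant [C]. *)
  pose n := (Num.truncn (C%:R / (d / 2))).+1.
  have pn : (p n)%:R <= d * n%:R.
    have : C%:R <= n%:R * (d / 2) by rewrite -ler_pdivrMr // ltW // truncnS_gt.
    by have := pC n; lra.
  have tau'01 : 0 <= tau < 1 by move: tau01; lra.
  have [Sne low] := @shrinking_target_lower R A X Y N p Yne cY N0 YN specY p0 Xs YX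
    phi z s c kappa tau (good tau tau01) k0 tau'01 kt n (ltn0Sn _).
  split => //.
  have := htop_le_words Yne N0 YN Xs XE (ltn0Sn _ : (0 < n)%N).
  rewrite hE lee_fin ler_pdivlMr ?ltr0n ?muln_gt0 // => hW.
  have dp : 0 < 1 + d by rewrite ltr_wpDr // ltW.
  have d1i : (1 + d)^-1 <= 1 by rewrite invf_le1 // lerDl ltW.
  have d1i' : 1 - d <= (1 + d)^-1.
    by rewrite -[leRHS]mul1r ler_pdivlMr //; nra.
  have main (K : R) : 0 <= K -> K * h / (1 + d) * ((n + p n) * N)%N%:R <=
      K * ln (#|lang Y (n * N)|%:R : R).
    move=> K0; apply: le_trans (_ : K * (h * (n * N)%N%:R) <= _); last by rewrite ler_wpM2l.
    have nN : ((n + p n) * N)%N%:R <= (1 + d) * (n * N)%N%:R :> R.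
      by rewrite !natrM natrD mulrA ler_wpM2r //; lra.
    have -> : K * (h * (n * N)%N%:R) = K * h / (1 + d) * ((1 + d) * (n * N)%N%:R).
      by field; rewrite gt_eqF.
    by apply: ler_wpM2l => //; rewrite divr_ge0 ?mulr_ge0 // ltW.
  have bound (K : R) : 0 <= K <= 2 -> K * h - 2 * d * h <= K * h / (1 + d).
    move=> /andP[K0 K2]; apply: le_trans (_ : K * h * (1 - d) <= _).
      have : K * (d * h) <= 2 * (d * h) by rewrite ler_wpM2r // mulr_ge0 // ltW.
      by lra.
    by rewrite ler_wpM2l // mulr_ge0.
  have kh : (a - 3 * d) * h <= kappa * h by rewrite ler_wpM2r.
  split.
    have s0 : 0 <= kappa * h / (1 + d) by rewrite divr_ge0 ?mulr_ge0 // ltW.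
    have [/(_ (main _ k0)) H _] := low _ s0.
    apply: le_trans H; rewrite lee_fin; apply: le_trans (bound kappa _); lra.
  have k10 : 0 <= 1 + kappa by rewrite addr_ge0.
  have s0 : 0 <= (1 + kappa) * h / (1 + d) by rewrite divr_ge0 ?mulr_ge0 // ltW.
  have [_ /(_ (main _ k10)) H] := low _ s0.
  apply: le_trans H; rewrite lee_fin; apply: le_trans (bound (1 + kappa) _); lra.
rewrite -/a a2; split.
- by have [] := key 1 ltr01.
- apply/lee_subgt0Pr => e /key[_ [H _]]; by rewrite -EFinB.
- apply/lee_subgt0Pr => e /key[_ [_ H]]; by rewrite -EFinB.
Qed.

Lemma shrinking_target_le (S : set B) (tau : R) : S `<=` X -> 0 <= tau ->
  (forall t, 0 <= t -> t = 0 \/ t < tau -> exists z : nat -> B,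
    forall x (n0 : nat), S x -> exists2 n, (n0 <= n)%N &
      agree (- (Num.truncn (t * n%:R))%:Z) (Num.truncn (t * n%:R))%:Z (shiftz n%:Z x) (z n)) ->
  (tau <= 1 -> (htop X f S <= ((1 - tau) / (1 + tau) * h)%:E)%E) /\
  (hausdorff_dim S <= (2 / (1 + tau) * h)%:E)%E.
Proof.
move=> SX tau0 H; have [y0 _] := Yne.
have tp : 0 < 1 + tau by rewrite ltr_wpDr.
pose g := 2 / (1 + tau).
have gE : (1 - tau) / (1 + tau) = g - 1 by rewrite /g; field; rewrite gt_eqF.
have key (e : R) : 0 < e -> exists t d z C, [/\ 0 <= t, tau <= 1 -> t < 1,
    0 <= C, (forall x (n0 : nat), S x -> exists2 n, (n0 <= n)%N &
      agree (- (Num.truncn (t * n%:R))%:Z) (Num.truncn (t * n%:R))%:Z (shiftz n%:Z x) (z n)) &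
    [/\ 0 <= h + d, forall M, (#|lang X M|%:R : R) <= C * expR ((h + d) * M%:R),
      2 / (1 + t) * (h + d) <= g * h + e &
      tau <= 1 -> (1 - t) / (1 + t) * (h + d) <= (g - 1) * h + e]].
  move=> e0; have h2 : 0 < 2 * h + 3 by rewrite ltr_wpDl // mulr_ge0.
  (* Replacing [tau] by [t] costs 2dh, replacing h by h + d at most 2d. *)
  pose d := e / (2 * h + 3); have d0 : 0 < d by rewrite divr_gt0.
  have dE : d * (2 * h + 3) = e by rewrite /d divfK // gt_eqF.
  (* The value 0 needs its own case in [H]: for tau = 0 no admissible t lies strictly below tau. *)
  pose t := Num.max 0 (tau - d).
  have t0 : 0 <= t by rewrite /t le_max lexx.
  have tt : tau - t <= d by rewrite lerBlDr -lerBlDl /t le_max lexx orbT.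
  have t_tau : t <= tau by rewrite /t ge_max tau0 gerBl ltW.
  have [z zP] : exists z : nat -> B, forall x (n0 : nat), S x -> exists2 n, (n0 <= n)%N &
      agree (- (Num.truncn (t * n%:R))%:Z) (Num.truncn (t * n%:R))%:Z (shiftz n%:Z x) (z n).
    apply: H => //; rewrite /t; case: (leP 0 (tau - d)) => _; [right|by left].
    by rewrite gtrBl.
  have hd : (htop X f X < (h + d)%:E)%E by rewrite hE lte_fin ltrDl.
  have [C C0 CM] := lang_growth Yne cY N0 YN specY p0 Xs YX XE hd.
  have t1p : 0 < 1 + t by rewrite ltr_wpDr.
  pose gt := 2 / (1 + t).
  have gtE : gt * (1 + t) = 2 by rewrite /gt divfK // gt_eqF.
  have gE' : g * (1 + tau) = 2 by rewrite /g divfK // gt_eqF.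
  have gt0 : 0 <= gt by rewrite divr_ge0 // ltW.
  have gt2 : gt <= 2 by rewrite /gt ler_pdivrMr //; lra.
  have gtg : gt <= g + 2 * d.
    have h3 : gt * (tau - t) <= 2 * d by apply: ler_pM => //; rewrite subr_ge0.
    rewrite -(ler_pM2r tp) mulrDl gE'.
    have : 0 <= 2 * d * tau by apply: mulr_ge0 => //; apply: mulr_ge0 => //; exact: ltW.
    lra.
  exists t, d, z, C; split => //.
    by move=> tau1; rewrite /t gt_max ltr01 /=; lra.
  have gth : gt * h <= (g + 2 * d) * h by rewrite ler_wpM2r.
  have gtd : gt * d <= 2 * d by rewrite ler_wpM2r // ltW.
  split => //; first by rewrite addr_ge0 // ltW.
    by rewrite -/gt; lra.
  have -> : (1 - t) / (1 + t) = gt - 1 by rewrite /gt; field; rewrite gt_eqF.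
  by move=> _; lra.
split=> [tau1|]; apply/lee_addgt0Pr => e /key[t [d [z [C [t0 t1 C0 zP [hd CM g1 g2]]]]]].
  have := @htop_upper R A y0 X S C (h + d) t z Xs C0 hd t0 CM SX zP (t1 tau1).
  by move=> /le_trans; apply; rewrite gE -EFinD lee_fin; exact: g2.
have := @hausdorff_dim_upper R A y0 X S C (h + d) t z Xs C0 hd t0 CM SX zP.
by move=> /le_trans; apply; rewrite -EFinD lee_fin.
Qed.

End Asymptotics.

Theorem theorem1p17 (R : realType) (A : finType) (X Y : set (biseq R A))
    (N : nat) (phi : nat -> nat -> R) (z : nat -> nat -> biseq R A)
    (s : nat -> nat -> nat)
    (f := @sigma_shift R A) (P := [set j : nat | (1 <= j)%N])
    (tau_sup := ereal_sup [set decay_limsup (phi j) | j in P])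
    (tau_inf := ereal_sup [set decay_liminf (phi j) | j in P])
    (S_inf := \bigcap_(j in P) shrinking_target X f (phi j) (z j) (range (s j))) :
  subshift X ->
  (exists x y, [/\ X x, X y & x <> y]) ->
  Y !=set0 -> compact Y -> Y `<=` X ->
  (0 < N)%N ->
  iter N f @` Y = Y ->
  X = \bigcup_(l in `I_N) (iter l f @` Y) ->
  nonuniform_spec Y (iter N f) ->
  (forall j n, P j -> 0 < phi j n <= 1) ->
  (forall j i, P j -> X (z j i)) ->
  (forall j i, P j -> (0 < s j i)%N) ->
  (forall j, P j -> s j @ \oo --> \oo) ->
  [/\ (tau_sup < 1)%E ->
      \bigcap_(j in P) Ind' f N (z j) (s j) Y !=set0 ->
      [/\ S_inf !=set0,
          (((1 - fine tau_sup) / (1 + fine tau_sup))%:E * htop X f X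
             <= htop X f S_inf
             <= ((1 - fine tau_inf) / (1 + fine tau_inf))%:E * htop X f X)%E,
          ((2 / (1 + fine tau_sup))%:E * htop X f X
             <= hausdorff_dim S_inf
             <= (2 / (1 + fine tau_inf))%:E * htop X f X)%E
        & Y = X -> N = 1%N ->
          (forall j, P j -> range (s j) = [set n | (0 < n)%N]) ->
          htop X f S_inf
            = (((1 - fine tau_inf) / (1 + fine tau_inf))%:E * htop X f X)%E /\
          hausdorff_dim S_inf = ((2 / (1 + fine tau_inf))%:E * htop X f X)%E],
      tau_inf = 1%E ->
      htop X f S_inf = 0%E /\ (hausdorff_dim S_inf <= htop X f X)%E
    & (1 < tau_inf)%E ->
      htop X f S_inf = 0%E /\ hausdorff_dim S_inf = 0%E].

Proof.
move=> [_ fX] _ Yne cY YX N0 YN XE spec phi01 zX s0 soo.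
have [p [_ p0 specY]] := spec (expR (- N%:R)) (expR_gt0 _).
have Xs c w : X w -> X (shiftz c w).
  by move=> Xw; have := @shiftz_stable R A 1 X c w fX Xw; rewrite mul1r.
have P1 : P 1%N by [].
have hfin := htop_fin_num Yne N0 YN Xs XE.
have hE : htop X f X = (fine (htop X f X))%:E by rewrite fineK.
have phi_gt0 j : P j -> forall n, 0 < phi j n.
  by move=> Pj n; have /andP[] := phi01 j n Pj.
have SX : S_inf `<=` X by move=> x /(_ 1%N P1)[].
have inf0 : (0 <= tau_inf)%E.
  apply: le_trans (decay_liminf_ge0 (fun n => phi01 1%N n P1)) _.
  by apply: ereal_sup_ubound; exists 1%N.
have inf_sup : (tau_inf <= tau_sup)%E.
  apply: ge_ereal_sup => _ [j Pj <-].
  by apply: le_trans (limn_einf_sup _) _; apply: ereal_sup_ubound; exists j.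
have [y0 _] := Yne.
(* The intersection lies in each single target set, so one [j] with liminf above t is enough. *)
have match_z t : 0 <= t -> t = 0 \/ (t%:E < tau_inf)%E -> exists z : nat -> biseq R A,
    forall x (n0 : nat), S_inf x -> exists2 n, (n0 <= n)%N &
      agree (- (Num.truncn (t * n%:R))%:Z) (Num.truncn (t * n%:R))%:Z (shiftz n%:Z x) (z n).
  move=> t0 [->|].
    by exists (fun=> y0) => x n0 _; exists n0 => //; rewrite mul0r truncn0 => k; clear; lia.
  move=> /ereal_sup_gt[_ [j Pj <-] tj].
  have [n1 n1P] := lt_decay_liminf tj (phi_gt0 j Pj).
  exists (z j) => x n0 /(_ j Pj)[_ /infinite_setP /(_ (maxn n0 n1))[n nn [_ xz]]].
  exists n; first by apply: leq_trans nn; exact: leq_maxl.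
  have xt : mdist (iter n f x) (z j n) < expR (- (t * n%:R)).
    by apply: lt_le_trans xz (n1P n _); apply: leq_trans nn; exact: leq_maxr.
  have r_le : (Num.truncn (t * n%:R))%:R <= t * n%:R by rewrite truncn_le mulr_ge0.
  have := mdist_lt_agree xt r_le; rewrite iter_shift.
  by apply: agree_sub => //; rewrite lerDl.
have upper tau : 0 <= tau -> (tau%:E <= tau_inf)%E ->
    (tau <= 1 -> (htop X f S_inf <= ((1 - tau) / (1 + tau))%:E * htop X f X)%E) /\
    (hausdorff_dim S_inf <= (2 / (1 + tau))%:E * htop X f X)%E.
  move=> tau0 taui; rewrite hE -!EFinM.
  apply: (shrinking_target_le Yne cY N0 YN specY p0 Xs YX XE SX tau0) => t t0 tt.
  apply: match_z => //; case: tt => [|tt]; [by left|right].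
  by apply: lt_le_trans taui; rewrite lte_fin.
have zero_htop : (1 <= tau_inf)%E -> htop X f S_inf = 0%E.
  move=> inf1; apply/eqP; rewrite eq_le htop_ge0 andbT.
  have [/(_ (lexx 1)) H _] := upper 1 ler01 inf1.
  by apply: le_trans H _; rewrite subrr mul0r mul0e.
split.
- move=> sup1 [c cInd].
  have sup_fin : tau_sup \is a fin_num.
    by rewrite ge0_fin_numE ?(le_trans inf0) // (lt_trans sup1) // ltry.
  have inf_fin : tau_inf \is a fin_num.
    by rewrite ge0_fin_numE // (le_lt_trans inf_sup) // (lt_trans sup1) // ltry.
  have supE := fineK sup_fin; have infE := fineK inf_fin.
  have sup01 : 0 <= fine tau_sup < 1.
    by rewrite -lee_fin -lte_fin supE sup1 andbT (le_trans inf0).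
  have inf01 : 0 <= fine tau_inf < 1.
    rewrite -lee_fin -lte_fin infE inf0 /=; exact: le_lt_trans inf_sup sup1.
  have [inf_ge0 inf_lt1] := andP inf01.
  have [upper1 upper2] : (fine tau_inf <= 1 ->
      (htop X f S_inf <= ((1 - fine tau_inf) / (1 + fine tau_inf))%:E * htop X f X)%E) /\
      (hausdorff_dim S_inf <= (2 / (1 + fine tau_inf))%:E * htop X f X)%E.
    by apply: upper => //; rewrite infE.
  have [|Sne low1 low2] := shrinking_target_ge Yne cY N0 YN specY p0 Xs YX XE
      (phi := phi) (z := z) (s := s) (c := c) sup01.
    move=> tau /andP[suptau _] j M Pj.
    have /decay_limsup_lt : (decay_limsup (phi j) < tau%:E)%E.
      apply: le_lt_trans (_ : tau_sup < _)%E; last by rewrite -supE lte_fin.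
      by apply: ereal_sup_ubound; exists j.
    move=> /(_ (phi_gt0 j Pj))[n0 n0P].
    have [[I1 I2] [/= I1N I2N /infinite_setP I12] Ic] := cInd j Pj.
    (* Infinitely many good indices yield arbitrarily large times because [s j] tends to
       infinity. *)
    have [i0 _ i0P] := soo j Pj [set m | (maxn M n0 <= m)%N] (nbhs_infty_ge _).
    have [i i0i [zi Ni]] := I12 i0.
    have /= si := i0P i i0i.
    exists (s j i); split; first by apply: leq_trans si; exact: leq_maxl.
    + by exists i.
    + by apply: n0P; apply: leq_trans si; exact: leq_maxr.
    by exists I1, I2.
  split => //.
  + by rewrite {1}hE -EFinM low1 upper1 // ltW.
  + by rewrite {1}hE -EFinM low2 upper2.
  move=> YX' N1 sP.
  (* With N = 1 and Y = X every positive time is admissible with c = 0, so times where [phi j] is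
     large infinitely often suffice and the liminf replaces the limsup. *)
  have [|_ low1' low2'] := shrinking_target_ge Yne cY N0 YN specY p0 Xs YX XE
      (phi := phi) (z := z) (s := s) (c := 0) inf01.
    move=> tau /andP[inftau _] j M Pj.
    have /decay_liminf_lt : (decay_liminf (phi j) < tau%:E)%E.
      apply: le_lt_trans (_ : tau_inf < _)%E; last by rewrite -infE lte_fin.
      by apply: ereal_sup_ubound; exists j.
    move=> /(_ (phi_gt0 j Pj) (maxn M 1))[T MT phiT].
    exists T; split => //; first by apply: leq_trans MT; exact: leq_maxl.
      by rewrite sP //=; apply: leq_trans MT; exact: leq_maxr.
    exists 0%N, 0%N; rewrite N1 dvd1z; split => //.
    by rewrite YX'; exists (z j T); first exact: zX.
  by split; apply/eqP; rewrite eq_le {2}hE -EFinM ?low1' ?low2' andbT // upper1 // ltW.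
- move=> inf1; split; first by rewrite zero_htop // inf1.
  have [|_] := upper 1 ler01; first by rewrite inf1.
  by rewrite (_ : 1 + 1 = 2 :> R) // divff // mul1e.
move=> inf1; split; first by rewrite zero_htop // ltW.
(* [tau_inf] may be infinite here, hence the separate choice t = 2. *)
have [t t1 tinf] : exists2 t : R, 1 < t & (t%:E < tau_inf)%E.
  move: inf1; case: (tau_inf) => [r| |] //.
    by rewrite lte_fin => r1; exists ((1 + r) / 2); rewrite ?lte_fin; lra.
  by move=> _; exists 2; rewrite ?ltry // ltr1n.
have t0 : 0 <= t by apply: ltW; apply: lt_trans t1.
have [z' z'P] := match_z t t0 (or_intror tinf).
have hlt : (htop X f X < (fine (htop X f X) + 1)%:E)%E by rewrite {1}hE lte_fin ltrDl.
have [C C0 CM] := lang_growth Yne cY N0 YN specY p0 Xs YX XE hlt.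
have h0 : 0 <= fine (htop X f X) + 1 by rewrite addr_ge0 // -lee_fin -hE htop_ge0.
exact: (hausdorff_dim_eq0 y0 Xs C0 h0 t0 CM SX z'P t1).
Qed.
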